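(* There exist universal constants $C_0>0$, $C_1>0$, $C>0$ and $n_0\in\mathbb{N}$ such that for every $n\in\mathbb{N}$ with $n\ge n_0$ the following hold. (1) There exists a convex body $K\subset\mathbb{R}^n$ such that, with $c_K$ denoting the center of its John ellipsoid $B_K$, the center of mass $x_K$ of $K$ does not lie in the ellipsoid $$c_K+\left(1-C_0\sqrt{\tfrac{\log(n)}{n}}\right)n\,(B_K-c_K),$$ i.e. in the John ellipsoid of $K$ scaled by the factor $\left(1-C_0\sqrt{\frac{\log (n)}{n}}\right)n$ about its center. (2) There exists a polytope $P\subset\mathbb{R}^n$ (which is a convex body) with at most $Cn^2$ facets such that, with $c_P$ denoting the center of its John ellipsoid $B_P$, the center of mass $x_P$ of $P$ does not lie in the ellipsoid $$c_P+C_1\tfrac{n}{\log(n)}\,(B_P-c_P),$$ i.e. in the John ellipsoid of $P$ scaled by the factor $C_1\frac{n}{\log (n)}$ about its center.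
   Context: A convex body in $\mathbb{R}^n$ is a convex compact subset with non-empty interior. The John ellipsoid $B_K$ of a convex body $K\subset\mathbb{R}^n$ is the unique ellipsoid of maximal volume contained in $K$ (existence and uniqueness are classical). The center of mass of $K$ is $x_K=\frac{1}{\mathrm{vol}(K)}\int_K x\,dx$. $\log$ is the natural logarithm. ''Universal constant'' means a number independent of $n$ and of all other data. *)

(* Defs.v *)
From HB Require Import structures.
From mathcomp Require Import all_boot all_order all_algebra.
From mathcomp Require Import all_classical all_reals all_analysis.

Set Implicit Arguments.
Unset Strict Implicit.
Unset Printing Implicit Defensive.
Import Order.TTheory GRing.Theory Num.Theory.
Import numFieldNormedType.Exports.
Local Open Scope classical_set_scope.
Local Open Scope ring_scope.

(* R^n is 'rV[R]_n, with its library topology. The library norm `|x| on row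
   vectors is the sup norm, so Euclidean notions go through [dotv] below. *)

(* The sigma-algebra on 'rV[T]_n generated by the coordinates, as in the
   library's instance for n.-tuple T; for T = R it is the Borel sigma-algebra. *)
Section measurable_rV.
Context {d} {T : sigmaRingType d} (n : nat).

Let coors (i : 'I_n) (x : 'rV[T]_n) : T := x ord0 i.

Let rV_set0 : g_sigma_preimage coors set0.
Proof. exact: sigma_algebra0. Qed.

Let rV_setC A : g_sigma_preimage coors A -> g_sigma_preimage coors (~` A).
Proof. exact: sigma_algebraC. Qed.

Let rV_bigcup (F : _^nat) : (forall i, g_sigma_preimage coors (F i)) ->
  g_sigma_preimage coors (\bigcup_i (F i)).
Proof. exact: sigma_algebra_bigcup. Qed.

HB.instance Definition _ := @isMeasurable.Build (measure_tuple_display d)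
  'rV[T]_n (g_sigma_preimage coors) rV_set0 rV_setC rV_bigcup.

End measurable_rV.

Lemma measurable_rV_coord d (T : sigmaRingType d) n (i : 'I_n) :
  measurable_fun [set: 'rV[T]_n] (fun x => x ord0 i).
Proof.
move=> _ Y mY; rewrite setTI; apply: sub_sigma_algebra => /=.
rewrite -bigcup_seq/=; exists i => /=; first by rewrite mem_index_enum.
by exists Y => //; rewrite setTI.
Qed.

Lemma measurable_fun_rV d1 d2 (T1 : measurableType d1) (T2 : measurableType d2)
    n (f : T1 -> 'rV[T2]_n) :
  (forall i, measurable_fun [set: T1] (fun x => f x ord0 i)) ->
  measurable_fun [set: T1] f.
Proof.
move=> mf; have prefS : g_sigma_preimage (fun i x => f x ord0 i) `<=` measurable.
  apply: smallest_sub; first exact: sigma_algebra_measurable.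
  case: n => [|n] in f mf *; first by rewrite big_ord0.
  rewrite -bigcup_mkord_ord; apply: bigcup_sub => i Ii.
  by move=> A [B mB <-]; exact: mf.
move=> _ A mA; apply: prefS.
rewrite (g_sigma_preimage_comp (fun i (x : 'rV[T2]_n) => x ord0 i) f).
by exists A.
Qed.

Section lebesgue_rV.
Context {R : realType}.

Definition rV_cons n (p : measurableTypeR R * 'rV[R]_n) : 'rV[R]_n.+1 :=
  \row_i (if unlift ord0 i is Some j then p.2 ord0 j else p.1).

Definition rV_behead n (x : 'rV[R]_n.+1) : 'rV[R]_n :=
  \row_j x ord0 (lift ord0 j).

Lemma measurable_rV_cons n : measurable_fun setT (@rV_cons n).
Proof.
apply: measurable_fun_rV => i; rewrite /rV_cons.
case: (unliftP ord0 i) => [j ->|->].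
  rewrite (_ : (fun _ => _) = (fun y : 'rV[R]_n => y ord0 j) \o snd); last first.
    by apply/funext => p /=; rewrite mxE liftK.
  apply: measurableT_comp; [exact: measurable_rV_coord|exact: measurable_snd].
rewrite (_ : (fun _ => _) = fst); first exact: measurable_fst.
by apply/funext => p /=; rewrite mxE unlift_none.
Qed.

Lemma measurable_rV_behead n : measurable_fun setT (@rV_behead n).
Proof.
apply: measurable_fun_rV => i.
rewrite (_ : (fun _ => _) = (fun x : 'rV[R]_n.+1 => x ord0 (lift ord0 i))).
  exact: measurable_rV_coord.
by apply/funext => x; rewrite mxE.
Qed.

Definition lebesgue_rV_step n
    (mu : {sigma_finite_measure set 'rV[R]_n -> \bar R}) :
  set 'rV[R]_n.+1 -> \bar R :=
  pushforward (lebesgue_measure \x mu)%E (@rV_cons n).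

Section step.
Variables (n : nat) (mu : {sigma_finite_measure set 'rV[R]_n -> \bar R}).

Let step0 : lebesgue_rV_step mu set0 = 0%E.
Proof. by rewrite /lebesgue_rV_step /pushforward preimage_set0 measure0. Qed.

Let step_ge0 A : (0 <= lebesgue_rV_step mu A)%E.
Proof. exact: integral_ge0. Qed.

Let step_sigma_additive : semi_sigma_additive (lebesgue_rV_step mu).
Proof.
move=> F mF tF mUF; rewrite /lebesgue_rV_step /pushforward preimage_bigcup.
have mpre A : measurable A -> measurable (@rV_cons n @^-1` A).
  by move=> mA; rewrite -[X in measurable X]setTI; exact: measurable_rV_cons.
apply: measure_semi_sigma_additive.
- by move=> k; exact: mpre.
- apply/trivIsetP => /= i j _ _ ij; rewrite -preimage_setI.
  by move/trivIsetP : tF => /(_ _ _ _ _ ij) ->//; rewrite preimage_set0.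
- by rewrite -preimage_bigcup; exact: mpre.
Qed.

HB.instance Definition _ := isMeasure.Build _ _ _
  (lebesgue_rV_step mu) step0 step_ge0 step_sigma_additive.

Let step_sigma_finite : sigma_finite setT (lebesgue_rV_step mu).
Proof.
have /sigma_finiteP[F [TF ndF Foo]] := sigma_finiteT (@lebesgue_measure R).
have /sigma_finiteP[G [TG ndG Goo]] := sigma_finiteT mu.
pose u (x : 'rV[R]_n.+1) : measurableTypeR R * 'rV[R]_n :=
  (x ord0 ord0, rV_behead x).
have mu_ : measurable_fun setT u.
  apply: measurable_fun_pair => /=.
    exact: (@measurable_rV_coord _ R _ ord0).
  exact: measurable_rV_behead.
have consK : cancel (@rV_cons n) u.
  move=> [a v]; congr pair; first by rewrite mxE unlift_none.
  by apply/rowP => j; rewrite !mxE liftK.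
exists (fun k => u @^-1` (F k `*` G k)).
  rewrite -preimage_bigcup -[LHS](preimage_setT u); congr (_ @^-1` _).
  rewrite -setXTT TF TG predeqE => -[x y]; split=> [|[k _ []]].
    move=> [/= [k _ Fkx] [l _ Gly]]; exists (maxn k l) => //; split.
    - by move: x Fkx; exact/subsetPset/ndF/leq_maxl.
    - by move: y Gly; exact/subsetPset/ndG/leq_maxr.
  by split; exists k.
move=> k; have [mF Fk] := Foo k; have [mG Gk] := Goo k; split.
  by rewrite -[X in measurable X]setTI; apply: mu_ => //; exact: measurableX.
rewrite /lebesgue_rV_step /pushforward -comp_preimage.
rewrite (_ : u \o _ = id); last by apply/funext => p /=; rewrite consK.
by rewrite preimage_id product_measure1E// lte_mul_pinfty// ge0_fin_numE.
Qed.

HB.instance Definition _ := Measure_isSigmaFinite.Build _ _ _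
  (lebesgue_rV_step mu) step_sigma_finite.

End step.

(* Lebesgue measure on R^n: the n-fold product of [lebesgue_measure]
   (a unit mass on the one-point space R^0). *)
Fixpoint lebesgue_rV n : {sigma_finite_measure set 'rV[R]_n -> \bar R} :=
  match n with
  | 0 => \d_(0 : 'rV[R]_0)
  | m.+1 => lebesgue_rV_step (lebesgue_rV m)
  end.

End lebesgue_rV.
Arguments lebesgue_rV R n : clear implicits.

Lemma lebesgue_rV_box (R : realType) n (A : 'I_n -> set (measurableTypeR R)) :
  (forall i, measurable (A i)) ->
  lebesgue_rV R n [set x | forall i, A i (x ord0 i)] =
  (\prod_(i < n) lebesgue_measure (A i))%E.
Proof.
elim: n A => [|n IH] A mA.
  rewrite big_ord0 /= diracE mem_set//.
  by case.
rewrite big_ord_recl -IH// /= /lebesgue_rV_step /pushforward.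
have mB : measurable [set x : 'rV[R]_n | forall i, A (lift ord0 i) (x ord0 i)].
  rewrite (_ : [set _ | _] =
    \bigcap_(i in [set: 'I_n]) ((fun x : 'rV[R]_n => x ord0 i) @^-1` A (lift ord0 i))).
    apply: fin_bigcap_measurable => [|i _]; first exact: finite_finset.
    by rewrite -[X in measurable X]setTI; apply: (@measurable_rV_coord _ R) => //; exact: mA.
  by apply/seteqP; split=> [x xA i _|x xA i]; [exact: xA|exact: (xA i I)].
rewrite -product_measure1E//; congr (_ \x _)%E.
apply/seteqP; split => -[a v] /=.
- move=> H; split; first by have := H ord0; rewrite mxE unlift_none.
  by move=> i; have := H (lift ord0 i); rewrite mxE liftK.
- case=> Ha Hv i; rewrite mxE; case: (unliftP ord0 i) => [j ->|->] //=.
Qed.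

Section convex_geometry.
Context {R : realType} {n : nat}.
Implicit Types (K P E B F : set 'rV[R]_n) (a c u v : 'rV[R]_n).

Definition dotv u v : R := \sum_(i < n) u ord0 i * v ord0 i.

Definition convex_body K :=
  [/\ convex_set (K : set (convex_lmodType 'rV[R]_n)), compact K & K° !=set0].

Definition center_of_mass K : 'rV[R]_n :=
  (fine (lebesgue_rV R n K))^-1 *:
    \row_(i < n) \int[lebesgue_rV R n]_(x in K) (x ord0 i).

Definition euclidean_ball : set 'rV[R]_n := [set x | dotv x x <= 1].

(* Nondegenerate solid ellipsoids: images of the closed unit ball under
   invertible affine maps. *)
Definition ellipsoid_centered c E :=
  exists2 A : 'M[R]_n, A \in unitmx &
    E = [set c + x *m A | x in euclidean_ball].

Definition max_volume_ellipsoid K B :=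
  [/\ exists c, ellipsoid_centered c B, B `<=` K &
      forall c E, ellipsoid_centered c E -> E `<=` K ->
        (lebesgue_rV R n E <= lebesgue_rV R n B)%E].

Definition john_ellipsoid K B := unique (max_volume_ellipsoid K) B.

Definition dilate c (s : R) B : set 'rV[R]_n := [set c + s *: (x - c) | x in B].

Definition halfspace a (b : R) : set 'rV[R]_n := [set x | dotv a x <= b].

Definition hyperplane a (b : R) : set 'rV[R]_n := [set x | dotv a x = b].

Definition polytope P :=
  bounded_set P /\
  exists (m : nat) (a : 'I_m -> 'rV[R]_n) (b : 'I_m -> R),
    (forall i, a i != 0) /\ P = \bigcap_i halfspace (a i) (b i).

(* The affine hull of the nonempty set F is x + V, with dim V = d. *)
Definition affine_dim F (d : nat) :=
  exists (x : 'rV[R]_n) (V : {vspace 'rV[R]_n}),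
    [/\ F x, forall y, F y -> y - x \in V,
        forall W : {vspace 'rV[R]_n},
          (forall y, F y -> y - x \in W) -> (V <= W)%VS
      & \dim V = d].

Definition exposed_face P F :=
  exists a (b : R),
    [/\ a != 0, P `<=` halfspace a b & F = P `&` hyperplane a b].

(* Faces of dimension n - 1 (every face of a polytope is exposed). *)
Definition facets P : set (set 'rV[R]_n) :=
  [set F | exposed_face P F /\ affine_dim F n.-1].

End convex_geometry.

(* Main.v *)
Require Import Defs.
From mathcomp Require Import all_boot all_order all_algebra.
From mathcomp Require Import all_classical all_reals all_analysis.
From mathcomp Require Import measurable_realfun ring lra.

Set Implicit Arguments.
Unset Strict Implicit.
Unset Printing Implicit Defensive.
Import Order.TTheory GRing.Theory Num.Theory.
Import numFieldNormedType.Exports.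
Local Open Scope classical_set_scope.
Local Open Scope card_scope.
Local Open Scope ring_scope.

(* Both bodies contain the unit ball and lie in the cone
     -1 <= x_0,  x_0 / n + b |x_j| <= 1  (1 <= j < n),  b = sqrt (1 - 1/n^2),
   whose 2n - 1 facets touch the ball at points carrying a John decomposition of
   the identity; hence the ball is their John ellipsoid. An additional
   constraint, which the ball satisfies and which widens linearly with x_0, makes
   the sections {x_0 = t} grow exponentially in t, so that the mass concentrates
   at the largest heights t at which the cone does not yet cut off most of the
   widened section.
   (1) The constraint |x'| <= 2 + x_0 / n on x' = (x_j)_(j >= 1): most of a ball
   of bounded radius lies in a cube of half side eps of order sqrt (log n / n),
   and the cone contains that cube up to height n (1 - eps).
   (2) The 2n^2 or so constraints |x_i| + |x_j| <= 3/2 + x_0 / n: up to a factor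
   linear in n, the section is the cube of half side (3/2 + x_0 / n) / 2 < 1,
   which the cone contains up to height n / 6. *)

(** * Lebesgue measure under triangular affine maps *)

Section volume.
Context {R : realType}.

(** Maximality has to be tested against every ellipsoid, while the measure at hand is an iterated
    integral. A QR decomposition bridges the gap: an ellipsoid determines its matrix only up to an
    orthogonal factor, and a triangular matrix with positive diagonal maps slices to slices, so that
    its volume ratio is the product of the diagonal. AM-GM against the trace then replaces symmetric
    square roots; the price is that the symmetry of an extremal matrix has to be derived. No density
    of heights is computed. The center of mass is located by playing a slab [s' <= x_0 <= t] against
    everything below [s]; such crude bounds lose only powers of n, which the growth of the sections
    outweighs. In (1) that growth alone would allow eps of order log n / n. The larger eps comes
    from the 2(n - 1) caps that the cube cuts off the ball: each has relative volume at most about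
    exp(- c n eps^2), and together they must stay below one half. *)

Lemma measurable_affine1 (r c : R) :
  measurable_fun setT ((fun t => t * r + c) : measurableTypeR R -> measurableTypeR R).
Proof.
apply: measurable_funD => //; apply: measurable_funM => //.
Qed.

(** Uniqueness of Lebesgue measure: the pushforward under [t * r + c], scaled by [r], gives
    half-open intervals their length. *)
Lemma lebesgue_measure_affine (r c : R) (A : set (measurableTypeR R)) :
  0 < r -> measurable A ->
  (r%:E * lebesgue_measure ((fun t => (t * r + c)%R) @^-1` A) =
  lebesgue_measure A)%E.
Proof.
move=> r0 mA.
pose f := (fun t => t * r + c) : measurableTypeR R -> measurableTypeR R.
pose m := mscale (NngNum (ltW r0)) (pushforward (@lebesgue_measure R) f).
change (m (measurable_affine1 r c) A = lebesgue_measure A).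
apply/esym/lebesgue_measure_unique => //= _ [[a b]] _ <-.
rewrite /m /mscale /= /pushforward /=.
rewrite (_ : _ @^-1` _ = `]((a - c) / r), ((b - c) / r)]%classic); last first.
  apply/seteqP; split=> t /=; rewrite !in_itv/= ltr_pdivrMr// ler_pdivlMr// ltrBlDr
    lerBrDr//.
rewrite !lebesgue_measure_itv/= !lte_fin ltr_pM2r ?invr_gt0// ltrD2r.
case: ifPn => ab; last by rewrite mule0.
rewrite -!EFinB -EFinM; congr EFin; field; lra.
Qed.

Lemma lebesgue_rV_cons n (A : set 'rV[R]_n.+1) :
  lebesgue_rV R n.+1 A =
  (\int[lebesgue_measure]_t lebesgue_rV R n [set y | A (rV_cons (t, y))])%E.
Proof.
rewrite /= /lebesgue_rV_step /pushforward /product_measure1.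
apply: eq_integral => t _ /=; congr (lebesgue_rV R n _).
by apply/seteqP; split=> y; rewrite /xsection/= inE.
Qed.

Lemma measurable_section n (A : set 'rV[R]_n.+1) : measurable A ->
  forall t, measurable [set y | A (rV_cons (t, y))].
Proof.
move=> mA t.
have mp : measurable (@rV_cons R n @^-1` A).
  by rewrite -[X in measurable X]setTI; exact: measurable_rV_cons.
have := measurable_xsection t mp.
by congr measurable; apply/seteqP; split=> y; rewrite /xsection/= inE.
Qed.

Lemma measurable_lebesgue_section n (A : set 'rV[R]_n.+1) : measurable A ->
  measurable_fun [set: measurableTypeR R]
    (fun t => lebesgue_rV R n [set y | A (rV_cons (t, y))]).
Proof.
move=> mA.
have mp : measurable (@rV_cons R n @^-1` A).
  by rewrite -[X in measurable X]setTI; exact: measurable_rV_cons.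
have := measurable_fun_xsection (lebesgue_rV R n) mp.
congr measurable_fun; apply/funext => t /=; congr (lebesgue_rV R n _).
by apply/seteqP; split=> y; rewrite /xsection/= inE.
Qed.

Lemma measurable_affine n p (T : 'M[R]_(n, p)) (c : 'rV[R]_p) :
  measurable_fun setT (fun y : 'rV[R]_n => y *m T + c).
Proof.
apply: measurable_fun_rV => i.
under eq_fun => y do rewrite !mxE.
apply: measurable_funD => //; apply: measurable_sum => k.
by apply: measurable_funM => //; exact: (measurable_rV_coord (T:=R)).
Qed.

Lemma measurable_affine_preimage n p (T : 'M[R]_(n, p)) (c : 'rV[R]_p) S :
  measurable S -> measurable ((fun y : 'rV[R]_n => y *m T + c) @^-1` S).
Proof. by move=> mS; rewrite -[X in measurable X]setTI; exact: measurable_affine. Qed.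

(** Fubini and induction on the dimension. By triangularity the first coordinate of the image
    depends on the first coordinate alone, so slices go to slices. The slice at height [t] is
    shifted by [t *: v], which is why a translation [c] is carried along. *)
Lemma lebesgue_rV_affine n (T : 'M[R]_n) (c : 'rV[R]_n) (S : set 'rV[R]_n) :
  (forall i j : 'I_n, (j < i)%N -> T i j = 0) -> (forall i, 0 < T i i) ->
  measurable S ->
  ((\prod_i T i i)%:E *
     lebesgue_rV R n ((fun y : 'rV[R]_n => y *m T + c)%R @^-1` S) =
   lebesgue_rV R n S)%E.
Proof.
elim: n T c S => [|n IH] T c S T0 Tp mS.
  rewrite big_ord0 mul1e; congr (lebesgue_rV R 0 _).
  by apply/seteqP; split=> y /=; rewrite (thinmx0 (y *m T + c)) (thinmx0 y).
rewrite big_ord_recl/=.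
pose T' : 'M[R]_n := \matrix_(i, j) T (lift ord0 i) (lift ord0 j).
pose v : 'rV[R]_n := \row_j T ord0 (lift ord0 j).
have E t (y : 'rV[R]_n) : rV_cons (t, y) *m T + c =
    rV_cons (t * T ord0 ord0 + c ord0 ord0, y *m T' + (t *: v + rV_behead c)).
  apply/rowP => j; rewrite !mxE big_ord_recl !mxE unlift_none.
  case: (unliftP ord0 j) => [k ->|->] /=; rewrite ?mxE.
    rewrite addrCA addrA; congr (_ + _); congr (_ + _).
    by apply: eq_bigr => i _; rewrite !mxE liftK.
  rewrite big1 ?addr0// => i _; rewrite !mxE liftK/= T0 ?mulr0//.
set phi := fun t => lebesgue_rV R n [set y | S (rV_cons (t, y))].
rewrite -/(lebesgue_rV R n.+1) !lebesgue_rV_cons -/phi EFinM -muleA.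
set D := \prod_(i < n) _.
have D0 : 0 <= D by apply: prodr_ge0 => i _; exact: ltW.
pose f : measurableTypeR R -> measurableTypeR R :=
  fun t => t * T ord0 ord0 + c ord0 ord0.
have eqphi t : (D%:E * lebesgue_rV R n [set y | S (rV_cons (t, y) *m T + c)%R] =
  phi (f t))%E.
  rewrite /phi -(IH T' (t *: v + rV_behead c) [set y | S (rV_cons (f t, y))]);
    first last.
  - exact: measurable_section.
  - by move=> i; rewrite mxE.
  - by move=> i j ij; rewrite mxE T0.
  congr (_ * _)%E; first by congr EFin; apply: eq_bigr => i _; rewrite mxE.
  by congr (lebesgue_rV R n _); apply/seteqP; split => y /=; rewrite E.
have mphi : measurable_fun [set: measurableTypeR R] phi
  by exact: measurable_lebesgue_section.
rewrite -ge0_integralZl//; last first.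
  exact: (measurable_lebesgue_section (measurable_affine_preimage T c mS)).
under eq_integral => t _ do rewrite [X in (_ * lebesgue_rV R n X)%E](_ : _ =
  [set y | S (rV_cons (t, y) *m T + c)])// eqphi.
(* Substitution in the outer integral: push the measure forward along [f]; the factor [T ord0 ord0]
   turns the result back into Lebesgue measure. *)
have mf : measurable_fun setT (f : measurableTypeR R -> measurableTypeR R).
  exact: measurable_affine1.
have pf := ge0_integral_pushforward mf (@lebesgue_measure R) measurableT mphi
  (fun t _ => measure_ge0 _ _).
rewrite preimage_setT in pf.
rewrite -[X in (_ * X)%E]pf.
have := @ge0_integral_mscale _ (measurableTypeR R) _ (pushforward lebesgue_measure f)
  setT measurableT (NngNum (ltW (Tp ord0))) phi mphi.
move=> /(_ (measurable_affine1 _ _) (fun t _ => measure_ge0 _ _)) H.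
apply: etrans (esym H) _; apply: eq_measure_integral => A mA _ /=.
exact: (lebesgue_measure_affine (c ord0 ord0) (Tp ord0) mA).
Qed.

Lemma measurable_coord_dep n (B : set (measurableTypeR R)) (A : set 'rV[R]_n) :
  measurable B -> measurable A ->
  measurable [set x : 'rV[R]_n.+1 | B (x ord0 ord0) /\ A (rV_behead x)].
Proof.
move=> mB mA; apply: measurableI.
  by rewrite -[X in measurable X]setTI; apply: (@measurable_rV_coord _ R).
by rewrite -[X in measurable X]setTI; apply: measurable_rV_behead.
Qed.

Lemma lebesgue_rV_prod n (B : set (measurableTypeR R)) (A : set 'rV[R]_n) :
  measurable B -> measurable A ->
  (lebesgue_rV R n.+1 [set x : 'rV[R]_n.+1 | B (x ord0 ord0) /\ A (rV_behead x)] =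
   lebesgue_measure B * lebesgue_rV R n A)%E.
Proof.
move=> mB mA; rewrite /= /lebesgue_rV_step /pushforward -product_measure1E//.
congr (_ \x _)%E; apply/seteqP; split => -[a v] /=.
  by rewrite mxE unlift_none (_ : rV_behead _ = v)//; apply/rowP=> j;
    rewrite !mxE liftK.
by rewrite mxE unlift_none (_ : rV_behead _ = v)//; apply/rowP=> j; rewrite !mxE liftK.
Qed.

Lemma lebesgue_rV_homothety n (r : R) (c : 'rV[R]_n) (S : set 'rV[R]_n) :
  0 < r -> measurable S ->
  (lebesgue_rV R n ((fun y : 'rV[R]_n => r^-1 *: (y - c))%R @^-1` S) =
   (r ^+ n)%:E * lebesgue_rV R n S)%E.
Proof.
move=> r0 mS.
rewrite -(@lebesgue_rV_affine n (r^-1)%:M (- (r^-1 *: c)) S)//; first last.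
- by move=> i; rewrite mxE eqxx mulr1n invr_gt0.
- by move=> i j ij; rewrite mxE -val_eqE/= gtn_eqF// mulr0n.
rewrite (eq_bigr (fun=> r^-1)); last by move=> i _; rewrite mxE eqxx.
rewrite prodr_const card_ord muleA -EFinM exprVn divff ?expf_neq0 ?gt_eqF// mul1e.
by congr (lebesgue_rV R n _); apply/seteqP; split=> y /=;
  rewrite mul_mx_scalar scalerBr.
Qed.

Lemma measurable_dotv n (p : nat) (f : 'rV[R]_p -> 'rV[R]_n) :
  measurable_fun setT f -> measurable_fun setT (fun x => dotv (f x) (f x)).
Proof.
move=> mf; apply: measurable_sum => i.
have mi : measurable_fun setT (fun x => f x ord0 i).
  exact: (measurableT_comp (measurable_rV_coord (T:=R) i) mf).
exact: measurable_funM.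
Qed.

Lemma measurable_le_set d (T : measurableType d) (f g : T -> R) :
  measurable_fun setT f -> measurable_fun setT g -> measurable [set x | f x <= g x].
Proof.
move=> mf mg; have := measurable_fun_ler mf mg.
move=> /(_ measurableT [set true]) /(_ _); rewrite setTI; exact.
Qed.

Lemma measurable_euclidean_ball n : measurable (@euclidean_ball R n).
Proof.
by apply: measurable_le_set => //; apply: measurable_dotv; exact: measurable_id.
Qed.

Lemma measurable_symmetric_box n (r : 'I_n -> R) :
  measurable [set x : 'rV[R]_n | forall i, `|x ord0 i| <= r i].
Proof.
have -> : [set x : 'rV[R]_n | forall i, `|x ord0 i| <= r i] =
    \bigcap_(i in [set: 'I_n]) [set x : 'rV[R]_n | `|x ord0 i| <= r i].
  by apply/seteqP; split=> x /= H i; [move=> _; exact: H|exact: H].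
apply: fin_bigcap_measurable => [|i _]; first exact: finite_finset.
apply: measurable_le_set => //; apply: measurableT_comp => //.
exact: (measurable_rV_coord (T:=R)).
Qed.

Lemma lebesgue_rV_symmetric_box n (r : 'I_n -> R) : (forall i, 0 <= r i) ->
  lebesgue_rV R n [set x : 'rV[R]_n | forall i, `|x ord0 i| <= r i] =
  (\prod_i (r i *+ 2))%:E.
Proof.
move=> r0.
have -> : [set x : 'rV[R]_n | forall i, `|x ord0 i| <= r i] =
    [set x | forall i, `[- r i, r i]%classic (x ord0 i)].
  by apply/seteqP; split => x /= H i; have := H i; rewrite in_itv/= ler_norml.
rewrite (@lebesgue_rV_box R n (fun i => `[- r i, r i]%classic))//.
rewrite -prodEFin; apply: eq_bigr => i _.
rewrite lebesgue_measure_itv/= lte_fin -EFinB opprK -mulr2n.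
have := r0 i; case: ifPn => //; rewrite -leNgt => H ri.
by rewrite (_ : r i = 0) ?mul0rn//; lra.
Qed.

Lemma measurable_cube n (r : R) :
  measurable [set x : 'rV[R]_n | forall i, `|x ord0 i| <= r].
Proof. exact: measurable_symmetric_box. Qed.

Lemma lebesgue_rV_cube n (r : R) : 0 <= r ->
  lebesgue_rV R n [set x : 'rV[R]_n | forall i, `|x ord0 i| <= r] = ((r *+ 2) ^+ n)%:E.
Proof.
by move=> r0; rewrite (lebesgue_rV_symmetric_box (r := fun=> r))// prodr_const card_ord.
Qed.

Lemma sub_ball_cube n : @euclidean_ball R n `<=`
  [set x : 'rV[R]_n | forall i, `|x ord0 i| <= 1].
Proof.
move=> x; rewrite /euclidean_ball/= /dotv => H i.
rewrite -(@expr_le1 _ 2)// real_normK ?num_real//.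
apply: le_trans H; rewrite (bigD1 i)//= expr2 lerDl.
by apply: sumr_ge0 => j _; rewrite -expr2 sqr_ge0.
Qed.

Lemma sub_cube_ball n :
  [set x : 'rV[R]_n | forall i, `|x ord0 i| <= n.+1%:R^-1] `<=` @euclidean_ball R n.
Proof.
move=> x /= H; rewrite /euclidean_ball/= /dotv.
apply: (@le_trans _ _ (\sum_(i < n) n.+1%:R^-1)).
  apply: ler_sum => i _; rewrite -expr2 -real_normK ?num_real// expr2.
  have := H i; have : n.+1%:R^-1 <= 1 :> R by rewrite invf_le1// ler1n.
  move=> h1 h2; apply: le_trans h2; rewrite ler_piMl//; apply: le_trans h1; exact: H.
rewrite sumr_const card_ord -[_ *+ n]mulr_natl ler_pdivrMr// mul1r ler_nat//.
Qed.

Lemma lebesgue_ball_gt0 n : (0 < lebesgue_rV R n euclidean_ball)%E.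
Proof.
apply: (@lt_le_trans _ _ (lebesgue_rV R n
  [set x : 'rV[R]_n | forall i, `|x ord0 i| <= n.+1%:R^-1])).
  by rewrite lebesgue_rV_cube// lte_fin exprn_gt0// pmulrn_lgt0.
apply: le_measure; rewrite ?inE.
- exact: measurable_cube.
- exact: measurable_euclidean_ball.
- exact: sub_cube_ball.
Qed.

Lemma lebesgue_ball_lty n : (lebesgue_rV R n euclidean_ball < +oo)%E.
Proof.
apply: (@le_lt_trans _ _ (lebesgue_rV R n
  [set x : 'rV[R]_n | forall i, `|x ord0 i| <= 1])).
  apply: le_measure; rewrite ?inE.
  - exact: measurable_euclidean_ball.
  - exact: measurable_cube.
  - exact: sub_ball_cube.
by rewrite lebesgue_rV_cube// ltry.
Qed.

Lemma lebesgue_rV_ball n (c : 'rV[R]_n) (r : R) : 0 < r ->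
  lebesgue_rV R n [set y | dotv (y - c) (y - c) <= r ^+ 2] =
  ((r ^+ n)%:E * lebesgue_rV R n euclidean_ball)%E.
Proof.
move=> r0; rewrite -(lebesgue_rV_homothety c r0 (@measurable_euclidean_ball n)).
congr (lebesgue_rV R n _); apply/seteqP; split=> y; rewrite /euclidean_ball/=;
  have -> : dotv (r^-1 *: (y - c)) (r^-1 *: (y - c)) = dotv (y - c) (y - c) / r ^+ 2.
- by rewrite /dotv mulr_suml; apply: eq_bigr => i _; rewrite !mxE; field;
  rewrite gt_eqF.
- by rewrite ler_pdivrMr ?exprn_gt0// mul1r.
- by rewrite /dotv mulr_suml; apply: eq_bigr => i _; rewrite !mxE; field;
  rewrite gt_eqF.
- by rewrite ler_pdivrMr ?exprn_gt0// mul1r.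
Qed.

Lemma measurable_dotv_ball n (c : 'rV[R]_n) (r : R) :
  measurable [set y | dotv (y - c) (y - c) <= r].
Proof.
apply: measurable_le_set => //; apply: (@measurable_dotv n n (fun y => y - c)).
apply: measurable_fun_rV => i; under eq_fun do rewrite !mxE.
by apply: measurable_funB => //; exact: (measurable_rV_coord (T:=R)).
Qed.

End volume.

(** * The Euclidean inner product and the QR decomposition *)

Section dot.
Context {R : realType} {n : nat}.
Implicit Types u v w : 'rV[R]_n.

Lemma dotvE u v : dotv u v = (u *m v^T) ord0 ord0.
Proof. by rewrite /dotv mxE; apply: eq_bigr => i _; rewrite mxE. Qed.

Lemma dotvC u v : dotv u v = dotv v u.
Proof. by apply: eq_bigr => i _; rewrite mulrC. Qed.

Lemma dotvDl u v w : dotv (u + v) w = dotv u w + dotv v w.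
Proof. by rewrite !dotvE mulmxDl mxE. Qed.

Lemma dotvDr u v w : dotv w (u + v) = dotv w u + dotv w v.
Proof. by rewrite dotvC dotvDl !(dotvC w). Qed.

Lemma dotvZl (a : R) u v : dotv (a *: u) v = a * dotv u v.
Proof. by rewrite !dotvE -scalemxAl mxE. Qed.

Lemma dotvZr (a : R) u v : dotv v (a *: u) = a * dotv v u.
Proof. by rewrite dotvC dotvZl dotvC. Qed.

Lemma dotvNl u v : dotv (- u) v = - dotv u v.
Proof. by rewrite -scaleN1r dotvZl mulN1r. Qed.

Lemma dotvNr u v : dotv v (- u) = - dotv v u.
Proof. by rewrite dotvC dotvNl dotvC. Qed.

Lemma dotv0l v : dotv 0 v = 0.
Proof. by rewrite dotvE mul0mx mxE. Qed.

Lemma dotv0r v : dotv v 0 = 0.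
Proof. by rewrite dotvC dotv0l. Qed.

Lemma dotv_ge0 u : 0 <= dotv u u.
Proof. by apply: sumr_ge0 => i _; rewrite -expr2 sqr_ge0. Qed.

Lemma dotv_eq0 u : dotv u u = 0 -> u = 0.
Proof.
move=> /psumr_eq0P H; apply/rowP => i; rewrite mxE.
have /eqP := H (fun i _ => sqr_ge0 (u ord0 i)) i isT.
by rewrite -expr2 sqrf_eq0 => /eqP.
Qed.

Lemma dotv_le1 u v : dotv u u <= 1 -> dotv v v <= 1 -> dotv u v <= 1.
Proof.
move=> hu hv; have := dotv_ge0 (u - v).
rewrite !(dotvDl, dotvDr, dotvNl, dotvNr) (dotvC v u); lra.
Qed.

Lemma dotv_trace u v : dotv u v = \tr (v^T *m u).
Proof. by rewrite mxtrace_mulC dotvE [RHS]big_ord1. Qed.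

End dot.

Lemma dotv_mulmx {R : realType} n p (u : 'rV[R]_n) (M : 'M[R]_(n, p)) (w : 'rV[R]_p) :
  dotv (u *m M) w = dotv u (w *m M^T).
Proof. by rewrite !dotvE trmx_mul trmxK mulmxA. Qed.

Section QR.
Context {R : realType}.

Definition orthogonal_mx n (O : 'M[R]_n) := O *m O^T = 1%:M.

Lemma orthogonal_mxC n (O : 'M[R]_n) : orthogonal_mx O -> O^T *m O = 1%:M.
Proof. exact: mulmx1C. Qed.

Lemma orthogonal_mxM n (O O' : 'M[R]_n) :
  orthogonal_mx O -> orthogonal_mx O' -> orthogonal_mx (O *m O').
Proof.
by move=> oO oO'; rewrite /orthogonal_mx trmx_mul mulmxA -(mulmxA O) oO' mulmx1.
Qed.

(** Reflection in the hyperplane orthogonal to [w = a - |a| e]. Since [<w, w> = 2 <a, w>], it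
    subtracts exactly [w] from [a]. For [w = 0] the identity serves. *)
Lemma householder n (a : 'rV[R]_n.+1) : exists2 H : 'M[R]_n.+1, orthogonal_mx H &
  a *m H = Num.sqrt (dotv a a) *: delta_mx 0 0.
Proof.
set r := Num.sqrt _; set e : 'rV[R]_n.+1 := delta_mx 0 0.
have ee : dotv e e = 1.
  rewrite /dotv (bigD1 ord0)//= big1 ?addr0 => [|i i0]; rewrite !mxE ?eqxx ?mul1r//.
  by rewrite (negPf i0) mul0r.
have rr : r ^+ 2 = dotv a a by rewrite sqr_sqrtr// dotv_ge0.
pose w := a - r *: e.
have [w0|w0] := eqVneq w 0.
  exists 1%:M; first by rewrite /orthogonal_mx trmx1 mulmx1.
  by rewrite mulmx1; apply/eqP; rewrite -subr_eq0 -/w w0.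
have ww : dotv w w != 0 by apply: contra_neq w0 => /dotv_eq0.
have S : (w^T *m w)^T = w^T *m w by rewrite trmx_mul trmxK.
have SS : (w^T *m w) *m (w^T *m w) = dotv w w *: (w^T *m w).
  rewrite mulmxA -(mulmxA w^T w w^T) (_ : w *m w^T = (dotv w w)%:M); last first.
    by apply/matrixP => i j; rewrite !ord1 dotvE [RHS]mxE eqxx.
  by rewrite -mulmxA mul_scalar_mx -scalemxAr.
have k2 : (2 / dotv w w) * dotv w w = 2 by rewrite divfK.
set k := 2 / dotv w w in k2 *.
exists (1%:M - k *: (w^T *m w)).
  move: S SS; generalize (w^T *m w) => P S SS.
  have E : (1%:M - k *: P)^T = 1%:M - k *: P.
    by apply/matrixP => i j; rewrite !mxE -[in LHS]S mxE eq_sym.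
  rewrite /orthogonal_mx E.
  rewrite mulmxBl mul1mx mulmxBr mulmx1 -scalemxAl -scalemxAr SS.
  by rewrite !scalerA -mulrA k2; apply/matrixP => i j; rewrite !mxE; ring.
rewrite mulmxBr mulmx1 -scalemxAr mulmxA.
rewrite (_ : a *m w^T = (dotv a w)%:M); last first.
  by apply/matrixP => i j; rewrite !ord1 dotvE [RHS]mxE eqxx.
rewrite mul_scalar_mx scalerA.
suff -> : k * dotv a w = 1 by rewrite scale1r opprB addrC subrK.
apply: (mulIf ww); rewrite mulrAC k2 mul1r /w.
rewrite !(dotvDl, dotvDr, dotvNl, dotvNr, dotvZl, dotvZr) ee (dotvC e a) -rr; ring.
Qed.

(** A Householder reflection turns the first column into a nonnegative multiple of the first unit
    vector; invertibility makes that multiple positive and the lower right block invertible, and the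
    induction continues there. *)
Lemma QR_decomposition n (A : 'M[R]_n) : A \in unitmx -> exists Q T : 'M[R]_n,
  [/\ orthogonal_mx Q, Q *m A = T,
      forall i j : 'I_n, (j < i)%N -> T i j = 0 & forall i, 0 < T i i].
Proof.
elim: n A => [|n IH] A uA.
  exists 1%:M, A; split; [|by rewrite mul1mx|by case|by case].
  by rewrite /orthogonal_mx trmx1 mulmx1.
have [H oH] := householder (col ord0 A)^T.
set r := Num.sqrt _ => Hr.
pose B : 'M[R]_(1 + n) := H^T *m A.
have Bcol : lsubmx B = r *: delta_mx 0 0.
  apply/colP => i; rewrite !mxE.
  have /rowP/(_ i) := Hr; rewrite !mxE => Hi.
  rewrite eqxx andbT /= in Hi *; rewrite -Hi.
  apply: eq_bigr => j _; rewrite !mxE mulrC; congr (A _ _ * _).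
  exact/val_inj.
have r0 : 0 <= r by exact: sqrtr_ge0.
have uB : B \in unitmx.
  rewrite unitmx_mul uA andbT unitmx_tr.
  by case/mulmx1_unit : oH.
have EB : B = block_mx r%:M (ursubmx B) 0 (drsubmx B).
  rewrite -[LHS]submxK; congr block_mx; apply/matrixP => i j.
    rewrite /ulsubmx; have /matrixP/(_ (lshift n i) j) := Bcol;
      rewrite !ord1 !mxE /= => ->.
    by rewrite mulr1n mulr1.
  have /matrixP/(_ (rshift 1 i) j) := Bcol; rewrite !ord1 !mxE /= => ->.
  by rewrite mulr0.
have : \det B != 0 by rewrite -unitfE -unitmxE.
rewrite EB det_ublock det_scalar1 mulf_eq0 negb_or => /andP[rn0 dn0].
have uD : drsubmx B \in unitmx by rewrite unitmxE unitfE.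
have [Q' [T' [oQ' QT T'0 T'p]]] := IH _ uD.
pose Q1 : 'M[R]_(1 + n) := block_mx 1%:M 0 0 Q'.
pose T1 : 'M[R]_(1 + n) := block_mx r%:M (ursubmx B) 0 T'.
have oQ1 : @orthogonal_mx (1 + n) Q1.
  rewrite /orthogonal_mx /Q1 tr_block_mx mulmx_block oQ' !trmx0 trmx1.
  by rewrite !(mulmx0, mul0mx) mulmx1 !addr0 add0r -scalar_mx_block.
have QB : Q1 *m B = T1.
  rewrite EB mulmx_block !(mulmx0, mul0mx) !mul1mx !addr0 !add0r.
  by rewrite QT.
exists (Q1 *m (H^T : 'M[R]_(1 + n))), T1; split.
- apply: (@orthogonal_mxM (1 + n)) => //.
  by rewrite /orthogonal_mx trmxK; exact: orthogonal_mxC.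
- by rewrite -mulmxA.
- move=> i j; case: (split_ordP (i : 'I_(1 + n))) => i' ->;
    case: (split_ordP (j : 'I_(1 + n))) => j' -> /=; rewrite ?ord1//=.
    by move=> _; apply: etrans (block_mxEdl _ _ _ _ _ _) _; rewrite mxE.
  rewrite ltn_add2l => ij; apply: etrans (block_mxEdr _ _ _ _ _ _) _.
  exact: T'0.
- move=> i; case: (split_ordP (i : 'I_(1 + n))) => i' ->.
    rewrite [X in 0 < X](_ : _ = r); first by rewrite lt_neqAle eq_sym rn0.
    by apply: etrans (block_mxEul _ _ _ _ _ _) _; rewrite !ord1 mxE eqxx.
  rewrite [X in 0 < X](_ : _ = T' i' i'); first exact: T'p.
  exact: block_mxEdr.
Qed.

Lemma ball_orthogonal n (O : 'M[R]_n) (x : 'rV[R]_n) : orthogonal_mx O ->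
  euclidean_ball x -> euclidean_ball (x *m O).
Proof.
move=> oO; rewrite /euclidean_ball/= dotv_mulmx -mulmxA oO mulmx1//.
Qed.

(** The ball absorbs the orthogonal factor of [A = Q^T *m T]. *)
Lemma ellipsoid_triangular n (c : 'rV[R]_n) (E : set 'rV[R]_n) :
  ellipsoid_centered c E -> exists2 T : 'M[R]_n,
    (forall i j : 'I_n, (j < i)%N -> T i j = 0) /\ (forall i, 0 < T i i) &
    E = [set c + x *m T | x in euclidean_ball].
Proof.
move=> [A uA ->]; have [Q [T [oQ QA T0 Tp]]] := QR_decomposition uA.
exists T => //; rewrite -QA; apply/seteqP; split => _ [x xB <-].
  exists (x *m Q^T); first apply: ball_orthogonal => //.
    by rewrite /orthogonal_mx trmxK; exact: orthogonal_mxC.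
  by rewrite -mulmxA (mulmxA Q^T) orthogonal_mxC// mul1mx.
by exists (x *m Q); [exact: ball_orthogonal|rewrite mulmxA].
Qed.

End QR.

(** * The ball as John ellipsoid *)

Section john.
Context {R : realType} {n : nat}.
Implicit Types (T : 'M[R]_n) (c : 'rV[R]_n).

Lemma upper_triangular_unitmx T :
  (forall i j : 'I_n, (j < i)%N -> T i j = 0) -> (forall i, 0 < T i i) ->
  T \in unitmx.
Proof.
move=> T0 Tp; rewrite unitmxE -det_tr det_trig; last first.
  by apply/is_trig_mxP => i j ij; rewrite mxE T0.
rewrite unitfE prodf_seq_neq0; apply/allP => i _ /=.
by rewrite mxE gt_eqF.
Qed.

Lemma lebesgue_triangular_ellipsoid T c :
  (forall i j : 'I_n, (j < i)%N -> T i j = 0) -> (forall i, 0 < T i i) ->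
  lebesgue_rV R n [set c + x *m T | x in euclidean_ball] =
  ((\prod_i T i i)%:E * lebesgue_rV R n euclidean_ball)%E.
Proof.
move=> T0 Tp; have uT := upper_triangular_unitmx T0 Tp.
set E := [set _ | _ in _].
have mE : measurable E.
  rewrite (_ : E = (fun y : 'rV[R]_n => y *m invmx T + - (c *m invmx T)) @^-1`
    euclidean_ball).
    by apply: measurable_affine_preimage; exact: measurable_euclidean_ball.
  apply/seteqP; split => [_ [x xB <-]|y] /=.
    by rewrite mulmxDl addrAC subrr add0r mulmxK.
  rewrite -mulmxBl => yB; exists ((y - c) *m invmx T) => //.
  by rewrite mulmxKV// addrC subrK.
rewrite -(lebesgue_rV_affine c T0 Tp mE); congr (_ * lebesgue_rV R n _)%E.
apply/seteqP; split => [y [x xB]|y yB] /=; last by exists y => //; rewrite addrC.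
by rewrite addrC => /addIr/(can_inj (mulmxK uT)) <-.
Qed.

Variables (I : finType) (w : I -> R) (u : I -> 'rV[R]_n).
Hypothesis w_gt0 : forall i, 0 < w i.
Hypothesis u_unit : forall i, dotv (u i) (u i) = 1.
Hypothesis u_centered : \sum_i w i *: u i = 0.
Hypothesis u_isotropic : \sum_i w i *: ((u i)^T *m u i) = 1%:M.

Lemma sum_dotv_contact c : \sum_i w i * dotv c (u i) = 0.
Proof.
transitivity (dotv c (\sum_i w i *: u i)); last by rewrite u_centered dotv0r.
rewrite dotvE linear_sum/= mulmx_sumr summxE; apply: eq_bigr => i _.
by rewrite linearZ/= -scalemxAr mxE dotvE.
Qed.

Lemma sum_quad_contact T : \sum_i w i * dotv (u i *m T) (u i) = \tr T.
Proof.
rewrite -[in RHS](mul1mx T) -u_isotropic mulmx_suml linear_sum/=.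
apply: eq_bigr => i _.
by rewrite dotv_trace -scalemxAl linearZ/= mulmxA.
Qed.

Lemma sum_weights : \sum_i w i = n%:R.
Proof.
rewrite -(mxtrace1 R n) -sum_quad_contact; apply: eq_bigr => i _.
by rewrite mulmx1 u_unit mulr1.
Qed.

Section ellipsoid.
Variables (c : 'rV[R]_n) (T : 'M[R]_n).
Hypothesis T0 : forall i j : 'I_n, (j < i)%N -> T i j = 0.
Hypothesis Tp : forall i, 0 < T i i.
Hypothesis sub_contact : forall i x, euclidean_ball x -> dotv (c + x *m T) (u i) <= 1.

(** Test each tangent half-space at the image of its own contact point and average with the weights:
    centering removes [c], isotropy produces the trace. *)
Lemma trace_le_dim : \tr T <= n%:R.
Proof.
have -> : \tr T = \sum_i w i * (dotv c (u i) + dotv (u i *m T) (u i)).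
  under eq_bigr do rewrite mulrDr.
  by rewrite big_split/= sum_dotv_contact sum_quad_contact add0r.
rewrite -sum_weights; apply: ler_sum => i _;
  rewrite -dotvDl ler_piMr ?(ltW (w_gt0 i))//.
by apply: sub_contact; rewrite /euclidean_ball/= u_unit.
Qed.

(** AM-GM on the diagonal, with the trace bounded by the dimension. The equality case is kept
    because uniqueness of the ellipsoid rests on it. *)
Lemma prod_diag_leif : \prod_i T i i <= 1 ?= iff [forall i, T i i == 1].
Proof.
have [n0|n0] := posnP n.
  split; first by rewrite big1// => i; have := ltn_ord i; rewrite {2}n0.
  rewrite big1 ?eqxx; last by move=> i; have := ltn_ord i; rewrite {2}n0.
  by apply/esym/forallP => i; have := ltn_ord i; rewrite {2}n0.
have nR : 0 < n%:R :> R by rewrite ltr0n.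
have AGM := @leif_AGM _ _ 'I_n (fun i => T i i) (fun i _ => ltW (Tp i)).
rewrite card_ord in AGM.
have tr0 : 0 <= \tr T by apply: sumr_ge0 => i _; exact: ltW.
have le1 : (\tr T / n%:R) <= 1 by rewrite ler_pdivrMr// mul1r trace_le_dim.
have le2 : \prod_i T i i <= (\tr T / n%:R) ^+ n by apply: le_trans AGM.1 _.
have le3 : (\tr T / n%:R) ^+ n <= 1 by rewrite exprn_ile1// divr_ge0.
split; first exact: le_trans le3.
apply/eqP/forallP => [P1 i|H]; last by rewrite big1// => i _; exact/eqP.
have tr1 : \tr T / n%:R = 1.
  apply/eqP; rewrite -(@pexpr_eq1 _ _ n)// ?divr_ge0//.
  by rewrite eq_le le3/=; move: le2; rewrite P1.
have := AGM.2; rewrite -/(\tr T) tr1 expr1n P1 eqxx => /esym/forall_inP H.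
have Ti j : T j j = T i i by have /forall_inP/(_ i isT)/eqP := H j isT.
have : \tr T = n%:R by rewrite -[LHS](divfK (lt0r_neq0 nR)) tr1 mul1r.
rewrite /mxtrace (eq_bigr (fun=> T i i))// sumr_const card_ord -[LHS]mulr_natl => /eqP.
by rewrite -subr_eq0 -{2}[n%:R]mulr1 -mulrBr mulf_eq0 gt_eqF//= subr_eq0.
Qed.

(** Equality in AM-GM gives a unit diagonal, hence equality in the averaged contact inequalities and
    in each of them. This makes every [u i] an eigenvector of [T^T], so [T] is symmetric; being also
    triangular with unit diagonal, it is the identity. *)
Lemma extremal_ellipsoid : 1 <= \prod_i T i i -> c = 0 /\ T = 1%:M.
Proof.
move=> P1; have T1 i : T i i = 1.
  apply/eqP; have := prod_diag_leif.2;
    rewrite eq_le P1 prod_diag_leif.1 => /esym/forallP; exact.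
have trT : \tr T = n%:R by rewrite /mxtrace (eq_bigr (fun=> 1))// sumr_const card_ord.
(* The distance from the center [c] to the tangent hyperplane at [u i]. *)
pose l i := 1 - dotv c (u i).
have le_l i : dotv (u i *m T) (u i) <= l i.
  rewrite lerBrDl -dotvDl; apply: sub_contact.
  by rewrite /euclidean_ball/= u_unit.
have eq_l i : dotv (u i *m T) (u i) = l i.
  have : \sum_i w i * (l i - dotv (u i *m T) (u i)) = 0.
    under eq_bigr do rewrite mulrBr.
    rewrite sumrB sum_quad_contact trT /l.
    under eq_bigr do rewrite mulrBr mulr1.
    by rewrite sumrB sum_weights sum_dotv_contact subr0 subrr.
  move=> /psumr_eq0P H.
  have /eqP : w i * (l i - dotv (u i *m T) (u i)) = 0.
    by apply: H => // j _; rewrite mulr_ge0 ?subr_ge0 ?(ltW (w_gt0 j)).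
  by rewrite mulf_eq0 gt_eqF//= subr_eq0 => /eqP.
(* [T u = l u] by the equality case of Cauchy-Schwarz. *)
have eig i : u i *m T^T = l i *: u i.
  set p := u i *m T^T.
  have pu : dotv p (u i) = l i by rewrite -eq_l dotvC dotv_mulmx.
  have pl x : euclidean_ball x -> dotv x p <= l i.
    move=> xB; rewrite -dotv_mulmx lerBrDl -dotvDl; exact: sub_contact.
  have [p0|p0] := eqVneq (dotv p p) 0.
    by rewrite -pu (dotv_eq0 p0) dotv0l scale0r.
  have pp : 0 < dotv p p by rewrite lt_def p0 dotv_ge0.
  set r := Num.sqrt (dotv p p).
  have r2 : r ^+ 2 = dotv p p by rewrite sqr_sqrtr// ltW.
  have r0 : 0 < r by rewrite sqrtr_gt0.
  have rl : r <= l i.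
    have := pl (r^-1 *: p); rewrite /euclidean_ball/= !(dotvZl, dotvZr) -r2.
    rewrite expr2 !mulKf ?gt_eqF// mulVf ?gt_eqF//; exact.
  apply/eqP; rewrite -subr_eq0; apply/eqP/dotv_eq0/eqP; rewrite eq_le dotv_ge0 andbT.
  rewrite !(dotvDl, dotvDr, dotvNl, dotvNr, dotvZl, dotvZr) u_unit pu (dotvC _ p).
  rewrite pu -r2.
  have : r ^+ 2 <= l i ^+ 2 by rewrite ler_sqr// nnegrE ltW// (lt_le_trans r0).
  lra.
(* Expanding [T^T] along the resolution of the identity writes it as a combination of the symmetric
   matrices [(u i)^T *m u i]. *)
have symT : T^T = T.
  have TE : T^T = \sum_i (w i * l i) *: ((u i)^T *m u i).
    rewrite -[LHS]mul1mx -u_isotropic mulmx_suml; apply: eq_bigr => i _.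
    by rewrite -scalemxAl -mulmxA eig -scalemxAr scalerA.
  rewrite -[RHS]trmxK TE linear_sum/=; apply: eq_bigr => i _.
  by rewrite linearZ/= trmx_mul trmxK.
have TI : T = 1%:M.
  apply/matrixP => i j; rewrite mxE; have [->|ij] := eqVneq i j; first by rewrite T1.
  have [ji|ji|/val_inj ji] := ltngtP j i; first by rewrite T0.
    by rewrite -symT mxE T0.
  by rewrite ji eqxx in ij.
split=> //.
(* With [T = 1] the contact equalities say that [c] is orthogonal to every [u i], and by isotropy
   the [u i] span the space. *)
rewrite -[LHS]mulmx1 -u_isotropic mulmx_sumr big1// => i _.
rewrite -scalemxAr mulmxA (_ : c *m _ = 0) ?mul0mx ?scaler0//.
apply/matrixP => k k'; rewrite !ord1 -dotvE mxE.
have := eq_l i; rewrite TI mulmx1 u_unit /l; lra.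
Qed.

End ellipsoid.

(** The ball has finite positive volume, so comparing an ellipsoid with it means comparing
    [\prod_i T i i] with 1. Of [K] only the tangent half-spaces at the contact points matter for the
    upper bound. *)
Lemma john_ellipsoid_ball (K : set 'rV[R]_n) :
  euclidean_ball `<=` K -> (forall i x, K x -> dotv x (u i) <= 1) ->
  john_ellipsoid K euclidean_ball.
Proof.
move=> BK Ku.
have key c T : (forall i j : 'I_n, (j < i)%N -> T i j = 0) -> (forall i, 0 < T i i) ->
    [set c + x *m T | x in euclidean_ball] `<=` K ->
    forall i x, euclidean_ball x -> dotv (c + x *m T) (u i) <= 1.
  by move=> T0 Tp sub i x xB; apply/Ku/sub; exists x.
have cB : ellipsoid_centered 0 (@euclidean_ball R n).
  exists 1%:M; first exact: unitmx1.
  apply/seteqP; split => [x xB|_ [x xB <-]]; last by rewrite mulmx1 add0r.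
  by exists x => //; rewrite mulmx1 add0r.
have Bfin : lebesgue_rV R n euclidean_ball \is a fin_num.
  by rewrite ge0_fin_numE// lebesgue_ball_lty.
split.
  split=> //; first by exists 0.
  move=> c E /ellipsoid_triangular[T [T0 Tp] ->] sub.
  rewrite lebesgue_triangular_ellipsoid// -[leRHS]mul1e.
  apply: lee_wpmul2r => //.
  by rewrite lee_fin; exact: (prod_diag_leif Tp (key _ _ T0 Tp sub)).1.
move=> B' [[c /ellipsoid_triangular[T [T0 Tp] ->]] sub maxB'].
have := maxB' 0 _ cB BK; rewrite lebesgue_triangular_ellipsoid//.
rewrite -(fineK Bfin) -EFinM lee_fin -{1}[fine _]mul1r ler_pM2r; last first.
  by rewrite fine_gt0// lebesgue_ball_gt0 lebesgue_ball_lty.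
move=> /(extremal_ellipsoid T0 Tp (key _ _ T0 Tp sub))[-> ->].
apply/seteqP; split => [x xB|_ [x xB <-]]; last by rewrite mulmx1 add0r.
by exists x => //; rewrite mulmx1 add0r.
Qed.

End john.

(** * Locating the center of mass *)

Section center.
Context {R : realType}.

Lemma measurable_lt_set d (T : measurableType d) (f g : T -> R) :
  measurable_fun setT f -> measurable_fun setT g -> measurable [set x | f x < g x].
Proof.
move=> mf mg; have := measurable_fun_ltr mf mg.
by move=> /(_ measurableT [set true]) /(_ _); rewrite setTI; exact.
Qed.

Lemma bounded_integrable d (T : measurableType d) (mu : {measure set T -> \bar R})
    (D : set T) (f : T -> R) (M : R) :
  measurable D -> (mu D < +oo)%E -> measurable_fun D f ->
  (forall x, D x -> `|f x| <= M) -> mu.-integrable D (EFin \o f).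
Proof.
move=> mD Doo mf fM; apply: measurable_bounded_integrable => //.
exists M; split; first exact: num_real.
by move=> N MN x Dx; exact: le_trans (fM x Dx) (ltW MN).
Qed.

Lemma Rintegral_indic_in d (T : measurableType d) (mu : {measure set T -> \bar R})
    (D A : set T) : measurable D -> measurable A ->
  \int[mu]_(x in D) \1_A x = fine (mu (A `&` D)).
Proof. by move=> mD mA; rewrite /Rintegral integral_indic. Qed.

(** On [K] the function [x_0 - s] is at least [-(s + 1)] below height [s], nonnegative between [s]
    and [s'], and at least [s' - s] above. The low part lies in [[-1, s]] times [A], of volume
    [(s + 1) |A|], and the high part contains [[s', t]] times [A'], so the hypothesis makes the
    integral of [x_0 - s] positive. *)
Lemma center_of_mass_gt n (K : set 'rV[R]_n.+1) (A A' : set 'rV[R]_n) (s s' t M : R) :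
  measurable K -> (lebesgue_rV R n.+1 K < +oo)%E ->
  (forall x, K x -> -1 <= x ord0 ord0 <= M) ->
  measurable A -> (lebesgue_rV R n A < +oo)%E ->
  measurable A' -> (lebesgue_rV R n A' < +oo)%E ->
  -1 <= s -> s <= s' -> s' <= t ->
  (forall x, K x -> x ord0 ord0 < s -> A (rV_behead x)) ->
  (forall x : 'rV[R]_n.+1, s' <= x ord0 ord0 <= t -> A' (rV_behead x) -> K x) ->
  (s + 1) ^+ 2 * fine (lebesgue_rV R n A) <
    (s' - s) * (t - s') * fine (lebesgue_rV R n A') ->
  s < center_of_mass K ord0 ord0.
Proof.
move=> mK Koo KM mA Aoo mA' A'oo s1 ss' s't KA A'K lt.
set mu := lebesgue_rV R n.+1.
have mx0 : measurable_fun setT (fun x : 'rV[R]_n.+1 => x ord0 ord0).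
  exact: (measurable_rV_coord (T:=R)).
pose Lo := [set x : 'rV[R]_n.+1 | x ord0 ord0 < s].
pose Hi := [set x : 'rV[R]_n.+1 | s' <= x ord0 ord0].
have mLo : measurable Lo by exact: measurable_lt_set.
have mHi : measurable Hi by exact: measurable_le_set.
have finite_in B : measurable B -> (mu (B `&` K) < +oo)%E.
  move=> mB; apply: le_lt_trans Koo; apply: le_measure; rewrite ?inE//.
  exact: measurableI.
have len (a b : R) : a <= b -> lebesgue_measure `[a, b]%classic = (b - a)%:E.
  move=> ab; rewrite lebesgue_measure_itv/= lte_fin; case: ltP => // ba.
  by rewrite (_ : a = b) ?subrr//; apply/le_anti/andP.
have finA : lebesgue_rV R n A \is a fin_num by rewrite ge0_fin_numE.
have finA' : lebesgue_rV R n A' \is a fin_num by rewrite ge0_fin_numE.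
have LoA : fine (mu (Lo `&` K)) <= (s + 1) * fine (lebesgue_rV R n A).
  rewrite -lee_fin EFinM !fineK// ?ge0_fin_numE// ?finite_in//.
  have -> : s + 1 = s - -1 by rewrite opprK.
  rewrite -len// -lebesgue_rV_prod//.
  apply: le_measure; rewrite ?inE.
  - exact: measurableI.
  - exact: measurable_coord_dep.
  - move=> x [/= xs Kx]; split; last exact: KA.
    by rewrite in_itv/= (ltW xs) andbT; case/andP: (KM _ Kx).
have HiA' : (t - s') * fine (lebesgue_rV R n A') <= fine (mu (Hi `&` K)).
  rewrite -lee_fin EFinM !fineK// ?ge0_fin_numE// ?finite_in//.
  rewrite -len// -lebesgue_rV_prod//.
  apply: le_measure; rewrite ?inE.
  - exact: measurable_coord_dep.
  - exact: measurableI.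
  - move=> x [/=]; rewrite in_itv/= => xt xA'; split; last exact: A'K.
    by case/andP : xt.
(* The strict hypothesis forces mass above [s'], so dividing by the volume is legitimate. *)
have Kfin : 0 < fine (mu K).
  rewrite fine_gt0// Koo andbT; apply: (@lt_le_trans _ _ (mu (Hi `&` K))); last first.
    by apply: le_measure; rewrite ?inE//; exact: measurableI.
  have : 0 < fine (mu (Hi `&` K)).
    have h : 0 <= (s + 1) ^+ 2 * fine (lebesgue_rV R n A).
      by rewrite mulr_ge0 ?sqr_ge0// fine_ge0.
    have := le_lt_trans h lt; rewrite -mulrA => {}h.
    have h2 : 0 <= fine (mu (Hi `&` K)) by exact: fine_ge0.
    rewrite lt_neqAle h2 andbT; apply: contraTneq h => h3.
    rewrite -leNgt mulr_ge0_le0 ?subr_ge0//; by rewrite (le_trans HiA')// -h3.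
  by rewrite -lte_fin fineK// ge0_fin_numE// finite_in.
have ix0 : mu.-integrable K (EFin \o (fun x : 'rV[R]_n.+1 => x ord0 ord0)).
  apply: (@bounded_integrable _ _ _ _ _ (1 + `|M|)) => //.
    exact: measurable_funS mx0.
  move=> x /KM /andP[x1 x2]; rewrite ler_norml; apply/andP; split.
    by have := normr_ge0 M; lra.
  by have := ler_norm M; lra.
have ics (r : R) : mu.-integrable K (EFin \o (fun=> r)).
  by apply: (@bounded_integrable _ _ _ _ _ `|r|).
have iind (r : R) B : measurable B -> mu.-integrable K (EFin \o (fun x => r * \1_B x)).
  move=> mB; apply: (@bounded_integrable _ _ _ _ _ `|r|) => //.
    by apply: measurable_funM => //; exact: measurable_indic.
  by move=> x _; rewrite normrM ler_piMr// indicE; case: (_ \in _);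
    rewrite ?normr1 ?normr0.
have iind1 B : measurable B -> mu.-integrable K (EFin \o (fun x => \1_B x)).
  move=> mB; apply: (@bounded_integrable _ _ _ _ _ 1) => //.
    exact: measurable_indic.
  by move=> x _; rewrite indicE; case: (_ \in _); rewrite ?normr1 ?normr0.
have lb : \int[mu]_(x in K) ((s' - s) * \1_Hi x - (s + 1) * \1_Lo x) <=
          \int[mu]_(x in K) (x ord0 ord0 - s).
  apply: le_Rintegral => //.
  - exact: (integrableB mK (iind _ _ mHi) (iind _ _ mLo)).
  - exact: (integrableB mK ix0 (ics s)).
  - move=> x Kx; rewrite !indicE.
    have /andP[x1 _] := KM x Kx.
    have -> : (x \in Hi) = (s' <= x ord0 ord0) by apply/idP/idP; rewrite inE.
    have -> : (x \in Lo) = (x ord0 ord0 < s) by apply/idP/idP; rewrite inE.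
    case: (leP s' (x ord0 ord0)) => h; case: (ltP (x ord0 ord0) s) => l;
      rewrite ?mulr1 ?mulr0; lra.
have eq1 : \int[mu]_(x in K) ((s' - s) * \1_Hi x - (s + 1) * \1_Lo x) =
    (s' - s) * fine (mu (Hi `&` K)) - (s + 1) * fine (mu (Lo `&` K)).
  rewrite RintegralB//; [|exact: iind|exact: iind].
  rewrite !RintegralZl//; [|exact: iind1|exact: iind1].
  by rewrite !Rintegral_indic_in.
have eq2 : \int[mu]_(x in K) (x ord0 ord0 - s) =
    \int[mu]_(x in K) (x ord0 ord0) - s * fine (mu K).
  rewrite (RintegralB mK ix0 (ics s)).
  by rewrite Rintegral_cst.
have pos : 0 < (s' - s) * fine (mu (Hi `&` K)) - (s + 1) * fine (mu (Lo `&` K)).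
  rewrite subr_gt0; apply: le_lt_trans (lt_le_trans lt _).
    by rewrite expr2 -mulrA ler_wpM2l// -lerBlDr sub0r.
  by rewrite -mulrA ler_wpM2l// subr_ge0.
rewrite /center_of_mass !mxE mulrC ltr_pdivlMr//.
by rewrite -subr_gt0 -eq2 (lt_le_trans _ lb)// eq1.
Qed.

End center.

(** * Facets *)

Section facets.
Context {R : realType} {n : nat}.
Implicit Types (P F : set 'rV[R]_n).

(** Either the facet lies in one of the given hyperplanes, and a dimension count identifies it with
    the face cut out there, or it would contain an interior point. *)
Lemma facet_of_halfspaces (I : finType) (a : I -> 'rV[R]_n) (b : I -> R) P F :
  (forall i, a i != 0) -> P = [set x | forall i, dotv (a i) x <= b i] ->
  facets P F -> exists i, F = P `&` hyperplane (a i) (b i).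
Proof.
move=> a0 PE [[a' [b' [a'0 Pa' FE]]] [x0 [V [Fx0 FV minV dimV]]]].
have [[i Fi]|noi] := pselect (exists i, F `<=` hyperplane (a i) (b i)).
  exists i; apply/seteqP; split => [y Fy|y [Py Hy]].
    by split; [move: Fy; rewrite FE => -[]|exact: Fi].
  rewrite FE; split=> //.
  pose f (v : 'rV[R]_n) := linfun (mulmxr v^T : 'rV[R]_n -> 'M[R]_1).
  have kerE v z : (z \in lker (f v)) = (dotv v z == 0).
    rewrite memv_ker lfunE/= dotvC dotvE; apply/eqP/eqP => [->|h]; first by rewrite mxE.
    by apply/matrixP => i' j'; rewrite !ord1 h mxE.
  have sub v c : F `<=` hyperplane v c -> (V <= lker (f v))%VS.
    move=> Fv; apply: minV => z Fz; rewrite kerE dotvDr dotvNr.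
    by rewrite (Fv _ Fz) (Fv _ Fx0) subrr.
  (* The directions of the facet have dimension n - 1 and lie in the kernel of the nonzero form
     [a i], hence fill it. Every point of [P] on this hyperplane then lies on the supporting
     hyperplane of [F] too. *)
  have kerV : lker (f (a i)) = V.
    apply/esym/eqP; rewrite eqEdim (sub _ _ Fi)/= dimV.
    have dimT : \dim {:'rV[R]_n} = n by rewrite dimvf /dim/= mul1n.
    have lt_dim : (\dim (lker (f (a i))) < n)%N.
      have le_dim : (\dim (lker (f (a i))) <= n)%N.
        by rewrite (leq_trans (dimvS (subvf _)))// dimT.
      rewrite ltn_neqAle le_dim andbT; apply: contra (a0 i) => dim_eq.
      have /eqP kT : lker (f (a i)) == fullv by rewrite eqEdim subvf/= dimT
        (eqP dim_eq).
      have : a i \in lker (f (a i)) by rewrite kT memvf.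
      by rewrite kerE => /eqP/dotv_eq0 ->.
    by rewrite -ltnS prednK// (leq_ltn_trans _ lt_dim).
  have : y - x0 \in lker (f a').
    apply: (subvP (sub a' b' _)); first by rewrite FE => z [].
    rewrite -kerV kerE dotvDr dotvNr Hy (Fi _ Fx0) subrr//.
  by rewrite kerE dotvDr dotvNr subr_eq0 => /eqP yx; rewrite /hyperplane/= yx;
    move: Fx0; rewrite FE => -[].
(* Otherwise averaging points of [F] off the hyperplanes gives a point of [F]
   interior to [P], contradicting that [F] lies on a supporting hyperplane. *)
have {}noi i : exists y, F y /\ dotv (a i) y < b i.
  apply: contrapT => /forallNP H; apply: noi; exists i => y Fy.
  have Py : P y by move: Fy; rewrite FE => -[].
  apply/eqP; rewrite eq_le [X in X && _](_ : _ = true); last by move: Py; rewrite PE;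
    exact.
  by rewrite leNgt; apply/negP => lt; exact: (H y).
have [y Hy] := choice noi.
have F_le i z : F z -> dotv (a i) z <= b i.
  by rewrite FE PE => -[+ _]; exact.
have F_eq z : F z -> dotv a' z = b' by rewrite FE => -[].
(* The point [x0] joins the average, so that it makes sense for empty [I]. *)
pose N : R := #|I|.+1%:R.
have N0 : 0 < N by rewrite ltr0n.
pose z := N^-1 *: (x0 + \sum_i y i).
have dz v : dotv v z = N^-1 * (dotv v x0 + \sum_i dotv v (y i)).
  rewrite dotvZr dotvDr; congr (_ * (_ + _)).
  by apply: (big_morph (dotv v)) => [u w|]; [exact: dotvDr|exact: dotv0r].
have sumc (r : R) : r + \sum_(i : I) r = N * r.
  by rewrite sumr_const -[r *+ _]mulr_natl -{1}[r]mul1r -mulrDl /N -natr1 addrC.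
have z_eq : dotv a' z = b'.
  rewrite dz F_eq// (eq_bigr (fun=> b')) => [|i _]; last by apply: F_eq; case: (Hy i).
  by rewrite sumc mulKf// gt_eqF.
have z_lt i : dotv (a i) z < b i.
  rewrite dz mulrC ltr_pdivrMr// mulrC -sumc.
  apply: ler_ltD; first exact: F_le.
  rewrite (bigD1 i)//= [ltRHS](bigD1 i)//=; apply: ltr_leD; first by case: (Hy i).
  by apply: ler_sum => j _; apply: F_le; case: (Hy j).
(* A step [S^-1] along [a'] stays within the slack of every constraint: the sum dominates each ratio
   of speed to slack, and the 1 keeps [S] positive. This step leaves the supporting half-space. *)
pose S := 1 + \sum_i `|dotv (a i) a'| / (b i - dotv (a i) z).
have S0 : 0 < S.
  rewrite ltr_pwDl// sumr_ge0// => i _.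
  by rewrite divr_ge0// subr_ge0 ltW.
have : P (z + S^-1 *: a').
  rewrite PE => i /=; rewrite dotvDr (dotvZr S^-1 a') -lerBrDl ler_pdivrMl//.
  have gi : 0 < b i - dotv (a i) z by rewrite subr_gt0.
  rewrite -ler_pdivrMr// /S (bigD1 i)//=.
  apply: (@le_trans _ _ (`|dotv (a i) a'| / (b i - dotv (a i) z))).
    by rewrite ler_pM2r ?invr_gt0// ler_norm.
  rewrite addrCA lerDl addr_ge0// sumr_ge0// => j _.
  by rewrite divr_ge0// subr_ge0 ltW.
move=> /Pa'; rewrite /halfspace/= dotvDr (dotvZr S^-1 a') z_eq gerDl pmulr_rle0
  ?invr_gt0// => h.
have /dotv_eq0 : dotv a' a' = 0 by apply/le_anti; rewrite h dotv_ge0.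
by move/eqP; rewrite (negPf a'0).
Qed.

Lemma card_facets (I : finType) (a : I -> 'rV[R]_n) (b : I -> R) P :
  (forall i, a i != 0) -> P = [set x | forall i, dotv (a i) x <= b i] ->
  facets P #<= `I_#|I|.
Proof.
move=> a0 PE.
(* Only the values on [k < #|I|] count; the default [set0] makes [f] total on [nat]. *)
pose f (k : nat) := if insub k is Some j then
  P `&` hyperplane (a (enum_val (j : 'I_#|I|))) (b (enum_val j)) else set0.
apply: card_le_trans (card_image_le f `I_#|I|).
apply: subset_card_le => F /(facet_of_halfspaces a0 PE)[i ->].
exists (enum_rank i : nat); first exact: (ltn_ord (enum_rank i)).
by rewrite /f valK enum_rankK.
Qed.

Lemma polytope_of_halfspaces (I : finType) (a : I -> 'rV[R]_n) (b : I -> R) P :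
  (forall i, a i != 0) -> P = [set x | forall i, dotv (a i) x <= b i] ->
  bounded_set P -> polytope P.
Proof.
move=> a0 PE Pb; split=> //; exists #|I|, (a \o enum_val), (b \o enum_val); split.
  by move=> i; exact: a0.
rewrite PE; apply/seteqP; split => [x H i _|x H i]; first exact: H.
by have := H (enum_rank i) Logic.I; rewrite /halfspace/= enum_rankK.
Qed.

End facets.

(** * The circumscribed cone *)

Section cone.
Context {R : realType} (m : nat).
Hypothesis m_gt0 : (0 < m)%N.
Local Notation n := (m.+1%:R : R).

Definition axis : 'rV[R]_m.+1 := delta_mx 0 ord0.
Definition side (j : 'I_m) : 'rV[R]_m.+1 := delta_mx 0 (lift ord0 j).

Lemma dotv_delta k (x : 'rV[R]_k) i : dotv x (delta_mx 0 i) = x ord0 i.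
Proof.
rewrite /dotv (bigD1 i)//= big1 ?addr0 => [|j ji]; rewrite mxE !eqxx ?mulr1//.
by rewrite (negPf ji) mulr0.
Qed.

(** Makes the slanted normals unit vectors with first coordinate 1/n. *)
Definition cone_slope : R := Num.sqrt (1 - n^-2).
Definition cone_normal (i : option ('I_m * bool)) : 'rV[R]_m.+1 :=
  if i is Some (j, e) then n^-1 *: axis + ((-1) ^+ e * cone_slope) *: side j
  else - axis.
(** John's conditions force these values. For contact points at height h, with base weight w0 and
    slanted weight w, they read w0 = 2mwh, 2w(1 - h^2) = 1 and w0 + 2mwh^2 = 1; eliminating the
    weights gives mh = 1 - h, that is h = 1/(m+1). *)
Definition cone_weight (i : option ('I_m * bool)) : R :=
  if i is Some _ then n ^+ 2 / (2 * (n ^+ 2 - 1)) else n / (n + 1).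

Lemma cone_slope_sq : cone_slope ^+ 2 = 1 - n^-2.
Proof.
have n1 : 1 <= n by rewrite ler1n.
by rewrite sqr_sqrtr// subr_ge0 invf_le1 ?exprn_gt0// exprn_ege1.
Qed.

Lemma cone_slope_ge0 : 0 <= cone_slope. Proof. exact: sqrtr_ge0. Qed.

Lemma cone_slope_le1 : cone_slope <= 1.
Proof.
rewrite -(@ler_sqr _ cone_slope 1) ?nnegrE ?cone_slope_ge0// cone_slope_sq expr1n.
by rewrite gerBl invr_ge0 exprn_ge0.
Qed.

Lemma dotv_axis x : dotv x axis = x ord0 ord0.
Proof. exact: dotv_delta. Qed.

Lemma dotv_side x j : dotv x (side j) = x ord0 (lift ord0 j).
Proof. exact: dotv_delta. Qed.

Lemma cone_weight_gt0 i : 0 < cone_weight i.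
Proof.
have n2_gt1 : 0 < n ^+ 2 - 1 by rewrite subr_gt0 exprn_egt1// ltr1n.
by case: i => [_|] /=; rewrite divr_gt0// ?exprn_gt0// ?mulr_gt0// addr_gt0.
Qed.

Lemma cone_normal_unit i : dotv (cone_normal i) (cone_normal i) = 1.
Proof.
case: i => [[j e]|] /=; rewrite ?(dotvDl, dotvDr, dotvNl, dotvNr, dotvZl, dotvZr).
  rewrite !(dotv_axis, dotv_side) !mxE !eqxx /=.
  have := cone_slope_sq; have := sqrr_sign R e; have : n != 0 by [].
  set s := (-1) ^+ e; set b := cone_slope; rewrite !expr2 => nn ss bb.
  transitivity (n^-1 * n^-1 + (s * s) * (b * b)); first by ring.
  by rewrite ss bb invfM; ring.
by rewrite dotv_axis mxE !eqxx opprK.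
Qed.

Lemma sum_cone_index (V : lmodType R) (f : option ('I_m * bool) -> V) :
  \sum_i f i = f None + \sum_j (f (Some (j, false)) + f (Some (j, true))).
Proof.
have -> : \sum_i f i = f None + \sum_(p : 'I_m * bool) f (Some p).
  rewrite (bigD1 None)//=; congr (_ + _).
  rewrite (reindex_omap some id)/=; last by case.
  by apply: eq_bigl => p; rewrite eqxx.
congr (_ + _); rewrite (eq_bigr (fun p => f (Some (p.1, p.2)))) => [|[]//].
rewrite -(pair_bigA _ (fun j e => f (Some (j, e))))/=.
by apply: eq_bigr => j _; rewrite big_bool addrC.
Qed.

Let denominators :
  [&& 1 + m%:R != 0 :> R, (1 + m%:R) ^+ 2 - 1 != 0 :> R & 1 + m%:R + 1 != 0 :> R].
Proof.
have mp : 0 < m%:R :> R by rewrite ltr0n.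
rewrite (_ : (1 + m%:R) ^+ 2 - 1 = m%:R * (m%:R + 2) :> R); last by ring.
by apply/and3P; split; rewrite gt_eqF// ?mulr_gt0//; lra.
Qed.

Lemma cone_centered : \sum_i cone_weight i *: cone_normal i = 0.
Proof.
rewrite sum_cone_index /=.
set w := n ^+ 2 / _.
rewrite (eq_bigr (fun=> (2 * w * n^-1) *: axis)); last first.
  by move=> j _; apply/rowP => k; rewrite !mxE expr0 expr1; ring.
rewrite sumr_const card_ord -[_ *: axis *+ m]scaler_nat scalerA scalerN -scaleNr
  -scalerDl.
rewrite [X in X *: _](_ : _ = 0) ?scale0r// /w.
field.
exact: denominators.
Qed.

(** The two mirror images of a slanted normal have opposite cross terms, so only the diagonal part
    survives in the sum. *)
Lemma outer_reflected (p q : R) (a s : 'rV[R]_m.+1) :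
  (p *: a + q *: s)^T *m (p *: a + q *: s) + (p *: a - q *: s)^T *m (p *: a - q *: s) =
  (2 * p ^+ 2) *: (a^T *m a) + (2 * q ^+ 2) *: (s^T *m s).
Proof. by apply/matrixP => k l; rewrite !mxE !big_ord1 !mxE; ring. Qed.

Lemma cone_isotropic :
  \sum_i cone_weight i *: ((cone_normal i)^T *m cone_normal i) = 1%:M.
Proof.
rewrite sum_cone_index /=.
set w := n ^+ 2 / _.
rewrite (eq_bigr (fun j => (w * (2 * n^-2)) *: (axis^T *m axis : 'M[R]_m.+1) +
   (w * (2 * cone_slope ^+ 2)) *: ((side j)^T *m side j))); last first.
  move=> j _; rewrite -scalerDr expr0 expr1 mul1r mulN1r scaleNr outer_reflected.
  by rewrite scalerDr !scalerA exprVn.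
rewrite mx1_sum_delta big_ord_recl big_split/= sumr_const card_ord addrA; congr (_ + _).
  have -> : (- axis)^T *m (- axis) = axis^T *m axis.
    by apply/matrixP => k l; rewrite !mxE !big_ord1 !mxE mulrNN.
  rewrite trmx_delta mul_delta_mx.
  rewrite -[_ *: _ *+ m]scaler_nat scalerA -scalerDl -[RHS]scale1r; congr (_ *: _).
    rewrite /w; field.
  exact: denominators.
apply: eq_bigr => j _; rewrite trmx_delta mul_delta_mx -[RHS]scale1r; congr (_ *: _).
rewrite cone_slope_sq /w; field.
by case/and3P: denominators => -> ->.
Qed.

End cone.

(** * Convex bodies between the ball and the cone *)

Section bodies.
Context {R : realType}.

Lemma bounded_set_coord n (K : set 'rV[R]_n) (M : R) : 0 <= M ->
  (forall x, K x -> forall i, `|x ord0 i| <= M) -> bounded_set K.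
Proof.
move=> M0 KM; exists M; split; first exact: num_real.
move=> N MN x Kx; apply: le_trans (ltW MN).
rewrite [leLHS]/Num.Def.normr/= mx_normrE; apply: bigmax_le => // -[i j] _ /=.
by rewrite ord1; exact: KM.
Qed.

Lemma closed_le0_set n (f : 'rV[R]_n -> R) : continuous f -> closed [set x | f x <= 0].
Proof.
move=> cf; apply: (@preimage_closed _ _ f [set y | y <= 0]); last exact: closed_le.
by move=> x _; exact: cf.
Qed.

Lemma interior_ball n : (@euclidean_ball R n)^° (0 : 'rV[R]_n).
Proof.
rewrite /interior; apply/nbhs_ballP; exists n.+1%:R^-1 => /=; first by rewrite invr_gt0.
move=> x [_ /= H]; apply: sub_cube_ball => i; apply: ltW.
by have := H ord0 i; rewrite /ball/= mxE sub0r normrN.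
Qed.

Lemma convex_setP n (K : set 'rV[R]_n) :
  (forall x y (t : R), 0 <= t <= 1 -> K x -> K y -> K (t *: x + (1 - t) *: y)) ->
  convex_set (K : set (convex_lmodType 'rV[R]_n)).
Proof.
move=> H x y t; rewrite !inE => Kx Ky; apply: H => //.
by rewrite ge0 le1.
Qed.

Lemma convex_body_ball n (K : set 'rV[R]_n) (M : R) : 0 <= M ->
  (forall x, K x -> forall i, `|x ord0 i| <= M) -> closed K ->
  (forall x y (t : R), 0 <= t <= 1 -> K x -> K y -> K (t *: x + (1 - t) *: y)) ->
  euclidean_ball `<=` K -> convex_body K.
Proof.
move=> M0 KM clK cK BK; split; first exact: convex_setP.
  by apply: bounded_closed_compact => //; exact: bounded_set_coord KM.
by exists 0; apply: interiorS BK _ _; exact: interior_ball.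
Qed.

(** Projection to the first axis suffices: the ball of radius [s] has no point with first coordinate
    above [s]. *)
Lemma not_dilate_ball n (s : R) (x : 'rV[R]_n.+1) : 0 <= s -> s < x ord0 ord0 ->
  ~ dilate 0 s euclidean_ball x.
Proof.
move=> s0 sx [y yB xE]; move: sx; rewrite -xE add0r subr0 mxE ltNge => /negP; apply.
by rewrite ler_piMr// (le_trans (ler_norm _))//; exact: (sub_ball_cube yB).
Qed.

Lemma ellipsoid_centered_ball n : ellipsoid_centered (0 : 'rV[R]_n) euclidean_ball.
Proof.
exists 1%:M; first exact: unitmx1.
apply/seteqP; split => [x xB|_ [x xB <-]]; last by rewrite mulmx1 add0r.
by exists x => //; rewrite mulmx1 add0r.
Qed.

Lemma lebesgue_coord_bounded n (K : set 'rV[R]_n) (M : R) : 0 <= M -> measurable K ->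
  (forall x, K x -> forall i, `|x ord0 i| <= M) -> (lebesgue_rV R n K < +oo)%E.
Proof.
move=> M0 mK KM.
apply: (@le_lt_trans _ _ (lebesgue_rV R n
  [set x : 'rV[R]_n | forall i, `|x ord0 i| <= M])).
  by apply: le_measure; rewrite ?inE//; exact: measurable_cube.
by rewrite lebesgue_rV_cube// ltry.
Qed.

Section cone_sets.
Variable m : nat.
Hypothesis m_gt0 : (0 < m)%N.
Local Notation n := (m.+1%:R : R).
Local Notation b := (@cone_slope R m).
Local Notation hd x := (x ord0 ord0).
Local Notation tl x j := (x ord0 (lift ord0 j)).

Definition cone : set 'rV[R]_m.+1 :=
  [set x | -1 <= hd x /\ forall j : 'I_m, hd x / n + b * `|tl x j| <= 1].

Lemma dotv_cone_normal (x : 'rV[R]_m.+1) j e :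
  dotv x (@cone_normal R m (Some (j, e))) = hd x / n + (-1) ^+ e * (b * tl x j).
Proof. by rewrite dotvDr !dotvZr dotv_axis dotv_side mulrA (mulrC (hd x)). Qed.

Lemma coneP (x : 'rV[R]_m.+1) : cone x <-> forall i, dotv x (@cone_normal R m i) <= 1.
Proof.
split=> [[x0 xj] [[j e]|]|H].
- rewrite dotv_cone_normal; apply: le_trans (xj j); rewrite lerD2l.
  rewrite (le_trans (ler_norm _))// normrM normr_sign mul1r normrM.
  by rewrite (ger0_norm (cone_slope_ge0 _)).
- by rewrite /= dotvNr dotv_axis lerNl.
- split; first by have := H None; rewrite /= dotvNr dotv_axis lerNl.
  (* The sign is chosen so that the signed coordinate is the absolute value. *)
  move=> j; have := H (Some (j, tl x j < 0)); rewrite dotv_cone_normal.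
  apply: le_trans; rewrite lerD2l mulrCA ler_wpM2l ?cone_slope_ge0//.
  by rewrite -normrEsign.
Qed.

Lemma ball_sub_cone : euclidean_ball `<=` cone.
Proof.
move=> x xB; apply/coneP => i; apply: dotv_le1 => //.
by rewrite cone_normal_unit.
Qed.

Lemma john_ellipsoid_in_cone (K : set 'rV[R]_m.+1) :
  euclidean_ball `<=` K -> K `<=` cone -> john_ellipsoid K euclidean_ball.
Proof.
move=> BK KC.
apply: (john_ellipsoid_ball (cone_weight_gt0 m_gt0) (@cone_normal_unit R m)
  (cone_centered m_gt0) (cone_isotropic m_gt0)) => //.
by move=> i x /KC/coneP; exact.
Qed.

Lemma cone_slope_ge_half : 1 / 2 <= b.
Proof.
rewrite -(@ler_sqr _ (1 / 2)) ?nnegrE ?cone_slope_ge0// cone_slope_sq//.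
suff : n^-2 <= 1 / 4 by rewrite [(1 / 2) ^+ 2]expr2; generalize (n^-2) => q h; lra.
rewrite (_ : 1 / 4 = 4^-1); last by rewrite div1r.
rewrite lef_pV2 ?posrE ?exprn_gt0//.
have : 2 <= n by rewrite ler_nat.
by rewrite !expr2; nra.
Qed.

(** The height is at most n by any slanted facet. Since [x_0 / n >= -1], the slope times [|x_j|] is
    at most 2, and the slope is at least 1/2, hence the 4. *)
Lemma cone_bounds (x : 'rV[R]_m.+1) : cone x ->
  hd x <= n /\ forall j : 'I_m, `|tl x j| <= 4.
Proof.
move=> [x0 xj]; have b2 := cone_slope_ge_half.
have n0 : 0 < n by [].
have n1 : n^-1 <= 1 by rewrite invf_le1// ler1n.
split=> [|j].
  rewrite -[leRHS]mul1r -ler_pdivrMr//; apply: le_trans (xj (Ordinal m_gt0)).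
  by rewrite lerDl mulr_ge0// cone_slope_ge0.
have xn : -1 <= hd x / n.
  apply: (@le_trans _ _ (- n^-1)); first by rewrite lerN2.
  by rewrite -mulN1r ler_wpM2r.
have bx : 1 / 2 * `|tl x j| <= b * `|tl x j| by rewrite ler_wpM2r.
move: (xj j) xn bx; set q := _ / n; set p := b * _; set r := `|_|; clearbody q p r; lra.
Qed.

Lemma cone_coord x : cone x -> forall i, `|x ord0 i| <= n + 4.
Proof.
move=> Cx i; have [x0 xj] := cone_bounds Cx.
have n0 : 0 <= n by [].
case: (unliftP ord0 i) => [j ->|->]; first by have := xj j; lra.
by rewrite ler_norml; have [h _] := Cx; apply/andP; split; lra.
Qed.

End cone_sets.
End bodies.

(** * The polytope *)

Lemma measure_bigcup_finType_le d (R : realType) (T : measurableType d)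
    (mu : {measure set T -> \bar R}) (I : finType) (F : I -> set T) (c : R) :
  (forall i, measurable (F i)) -> (forall i, (mu (F i) <= c%:E)%E) ->
  (mu (\bigcup_(i in [set: I]) F i) <= (#|I|%:R * c)%:E)%E.
Proof.
move=> mF Fc.
pose G k := if insub k is Some i then F (enum_val (i : 'I_#|I|)) else set0.
have GE (i : 'I_#|I|) : G i = F (enum_val i) by rewrite /G valK.
apply: (@le_trans _ _ (\sum_(k < #|I|) mu (G k))%E).
  apply: content_subadditive => //.
  - by move=> k km; rewrite -[k]/(val (Ordinal (km : (k < #|I|)%N))) GE.
  - by apply: fin_bigcup_measurable => //; exact: finite_finset.
  move=> x [i _ Fx]; rewrite -bigcup_mkord; exists (enum_rank i : nat).
    exact: (ltn_ord (enum_rank i)).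
  by rewrite GE enum_rankK.
apply: (@le_trans _ _ (\sum_(k < #|I|) c%:E)%E).
  by apply: lee_sum => k _; rewrite GE.
by rewrite sumEFin sumr_const card_ord mulr_natl.
Qed.

Section halfspaces.
Context {R : realType} {n : nat}.
Variables (I : Type) (a : I -> 'rV[R]_n) (b : I -> R).
Local Notation P := [set x | forall i, dotv (a i) x <= b i].

Lemma continuous_dotv v : continuous (fun x : 'rV[R]_n => dotv v x).
Proof.
rewrite /dotv; elim: (index_enum _) => [|i s IH].
  by under eq_fun do rewrite big_nil; exact: cst_continuous.
under eq_fun do rewrite big_cons.
move=> x; apply: (@continuousD _ _ _ (fun y : 'rV[R]_n => v ord0 i * y ord0 i) _ x);
  last exact: IH.
by apply: (@continuousM _ _ (fun=> v ord0 i) (fun y : 'rV[R]_n => y ord0 i) x);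
  [exact: cst_continuous|exact: coord_continuous].
Qed.

Lemma closed_halfspaces : closed P.
Proof.
have -> : P = \bigcap_(i in [set: I]) [set x | dotv (a i) x - b i <= 0].
  apply/seteqP; split=> x H i.
    by move=> _; rewrite /= subr_le0; exact: H.
  by have := H i Logic.I; rewrite /= subr_le0.
apply: closed_bigI => i _; apply: closed_le0_set => x.
apply: (@continuousB _ _ _ (fun y : 'rV[R]_n => dotv (a i) y) (fun=> b i) x).
  exact: continuous_dotv.
exact: cst_continuous.
Qed.

Lemma convex_halfspaces x y (t : R) : 0 <= t <= 1 -> P x -> P y ->
  P (t *: x + (1 - t) *: y).
Proof.
move=> /andP[t0 t1] Px Py i /=; rewrite dotvDr !dotvZr.
have -> : b i = t * b i + (1 - t) * b i by ring.
by apply: lerD; rewrite ler_wpM2l ?subr_ge0.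
Qed.

End halfspaces.

Lemma measurable_halfspaces {R : realType} n (I : finType) (a : I -> 'rV[R]_n) (b : I -> R) :
  measurable [set x | forall i, dotv (a i) x <= b i].
Proof.
have -> : [set x | forall i, dotv (a i) x <= b i] =
    \bigcap_(i in [set: I]) [set x | dotv (a i) x <= b i].
  by apply/seteqP; split=> x /= H i; [move=> _; exact: H|exact: H].
apply: fin_bigcap_measurable => [|i _]; first exact: finite_finset.
apply: measurable_le_set => //; apply: measurable_sum => k.
by apply: measurable_funM => //; exact: (measurable_rV_coord (T:=R)).
Qed.

Section pairs.
Context {R : realType} (m : nat).
Hypothesis m_gt0 : (0 < m)%N.
Local Notation n := (m.+1%:R : R).
Local Notation hd x := (x ord0 ord0).
Local Notation tl x j := (x ord0 (lift ord0 j)).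

(** On the diagonal [i = j] the second term is dropped, leaving [|x_i| <= 3/2 + x_0 / n]; two equal
    terms would demand [2 |x_i| <= 3/2 + x_0 / n], which the ball violates. *)
Definition pair_normal (p : 'I_m * 'I_m * (bool * bool)) : 'rV[R]_m.+1 :=
  let: (i, j, (e, f)) := p in
  - n^-1 *: axis m + (-1) ^+ e *: side i +
  (if i == j then 0 else (-1) ^+ f *: side j).

Definition pair_index : finType := (option ('I_m * bool) + 'I_m * 'I_m * (bool * bool))%type.

Definition pair_polytope_normal (k : pair_index) :=
  match k with inl i => @cone_normal R m i | inr p => pair_normal p end.

Definition pair_polytope_bound (k : pair_index) : R :=
  if k is inl _ then 1 else 3 / 2.

Definition pair_polytope : set 'rV[R]_m.+1 :=
  [set x | forall k, dotv (pair_polytope_normal k) x <= pair_polytope_bound k].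

Lemma dotv_pair_normal x i j e f : dotv (pair_normal (i, j, (e, f))) x =
  - (hd x / n) + (-1) ^+ e * tl x i + (if i == j then 0 else (-1) ^+ f * tl x j).
Proof.
rewrite dotvC /pair_normal; case: eqP => _;
  rewrite !dotvDr ?dotv0r !dotvZr dotv_axis !dotv_side mulNr (mulrC (hd x))//.
Qed.

Lemma pair_polytopeP x : pair_polytope x <->
  [/\ cone x, forall i : 'I_m, `|tl x i| <= 3 / 2 + hd x / n &
      forall i j : 'I_m, i != j -> `|tl x i| + `|tl x j| <= 3 / 2 + hd x / n].
Proof.
split=> [H|[Cx H1 H2] [k|[[i j] [e f]]]].
- split.
  + by apply/coneP => i; rewrite dotvC; exact: (H (inl i)).
  + move=> i; have : dotv (pair_normal (i, i, (tl x i < 0, true))) x <= 3 / 2 :=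
      H (inr (i, i, (tl x i < 0, true))).
    rewrite dotv_pair_normal eqxx addr0 -normrEsign; set q := hd x / n; clearbody q;
      lra.
  + move=> i j ij; have : dotv (pair_normal (i, j, (tl x i < 0, tl x j < 0))) x <= 3 / 2 :=
      H (inr (i, j, (tl x i < 0, tl x j < 0))).
    rewrite dotv_pair_normal (negPf ij) -!normrEsign; set q := hd x / n; clearbody q;
      lra.
- by rewrite dotvC; move/coneP: Cx; exact.
- change (dotv (pair_normal (i, j, (e, f))) x <= 3 / 2).
  rewrite dotv_pair_normal; have s (g : bool) l : (-1) ^+ g * tl x l <= `|tl x l|.
    by rewrite (le_trans (ler_norm _))// normrM normr_sign mul1r.
  have := s e i; have := s f j; have := H1 i.
  set q := hd x / n; set u := _ * tl x i; set v := _ * tl x j.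
  case: eqVneq => [_|/H2]; rewrite -/q; clearbody q u v; lra.
Qed.

Lemma pair_normal_neq0 p : pair_normal p != 0.
Proof.
move: p => [[i j] [e f]]; apply/eqP => p0.
have := dotv_pair_normal (axis m) i j e f; rewrite p0 dotv0l !mxE !eqxx /=.
case: (i == j) => /=; rewrite ?mulr0 !addr0 mul1r => /esym/eqP;
  by rewrite oppr_eq0 invr_eq0 pnatr_eq0.
Qed.

Lemma pair_polytope_normal_neq0 k : pair_polytope_normal k != 0.
Proof.
case: k => [i|p] /=; last exact: pair_normal_neq0.
apply/eqP => n0; have := @cone_normal_unit R m i; rewrite n0 dotv0l => /esym/eqP.
by rewrite oner_eq0.
Qed.

Lemma pair_polytope_cone : pair_polytope `<=` @cone R m.
Proof. by move=> x /pair_polytopeP[]. Qed.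

(** Cauchy-Schwarz for [|x_0| / 2 + |x_i| + |x_j|], as 1/n <= 1/2: the constant 3/2 is the norm of
    (1/2, 1, 1). *)
Lemma ball_sub_pair_polytope : euclidean_ball `<=` pair_polytope.
Proof.
move=> x xB; have [x0 xj] := ball_sub_cone xB.
have n2 : n^-1 <= 1 / 2 by rewrite div1r lef_pV2 ?posrE// ler_nat.
(* AM-GM replaces each absolute value by a quadratic bound. The values of [r] give every square the
   coefficient 3/4, and 3/4 + 1/12 + 1/3 + 1/3 = 3/2. *)
have lin (r y : R) : 0 < r -> `|y| <= (r * y ^+ 2 + r^-1) / 2.
  move=> r0; rewrite -real_normK ?num_real//; set z := `|y|.
  have : 0 <= r * (z - r^-1) ^+ 2 by rewrite mulr_ge0 ?sqr_ge0// ltW.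
  have -> : r * (z - r^-1) ^+ 2 = r * z ^+ 2 - 2 * z + r^-1 by field; rewrite gt_eqF.
  lra.
have hdl : `|hd x / n| <= 3 / 4 * hd x ^+ 2 + 1 / 12.
  have h := lin 3 (hd x) ltac:(by []).
  rewrite normrM [`|n^-1|]ger0_norm//.
  have : `|hd x| * n^-1 <= `|hd x| * (1 / 2) by rewrite ler_wpM2l.
  move: h; set c := `|hd x| * n^-1; clearbody c.
  lra.
have tll j : `|tl x j| <= 3 / 4 * tl x j ^+ 2 + 1 / 3.
  have := lin (3 / 2) (tl x j) ltac:(lra).
  have -> : (3 / 2)^-1 = 2 / 3 :> R by field.
  lra.
have xx : hd x ^+ 2 + \sum_j tl x j ^+ 2 <= 1.
  move: xB; rewrite /euclidean_ball/= /dotv big_ord_recl -expr2.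
  by rewrite (eq_bigr (fun j : 'I_m => tl x j ^+ 2)).
have hdn := ler_norm (- (hd x / n)); rewrite normrN in hdn.
apply/pair_polytopeP; split; first by split.
  move=> i; have := tll i; move: xx; rewrite (bigD1 i)//=.
  set s := \sum_(_ | _) _ => xx; have s0 : 0 <= s by apply: sumr_ge0 => *;
    exact: sqr_ge0.
  move: hdl hdn; set q := hd x / n; clearbody q; lra.
move=> i j ij; have := tll i; have := tll j; move: xx;
  rewrite (bigD1 i)//= (bigD1 j) 1?eq_sym//=.
set s := \sum_(_ | _) _ => xx; have s0 : 0 <= s by apply: sumr_ge0 => *; exact: sqr_ge0.
move: hdl hdn; set q := hd x / n; clearbody q; lra.
Qed.

Lemma pair_polytope_coord x : pair_polytope x -> forall i, `|x ord0 i| <= n + 4.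
Proof. move=> /pair_polytope_cone; exact: cone_coord. Qed.

Lemma pair_polytope_body : convex_body pair_polytope.
Proof.
apply: (@convex_body_ball _ _ _ (n + 4)) => //.
- exact: pair_polytope_coord.
- exact: closed_halfspaces.
- by move=> x y t; exact: convex_halfspaces.
- exact: ball_sub_pair_polytope.
Qed.

Lemma pair_polytope_polytope : polytope pair_polytope.
Proof.
apply: (polytope_of_halfspaces pair_polytope_normal_neq0 erefl).
by apply: (@bounded_set_coord _ _ _ (n + 4)) => //; exact: pair_polytope_coord.
Qed.

Lemma card_pair_polytope_facets :
  facets pair_polytope #<= `I_(1 + m * 2 + m * m * 4).
Proof.
apply: card_le_trans (card_facets pair_polytope_normal_neq0 erefl) _.
by rewrite card_le_II card_sum card_option !card_prod card_ord card_bool.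
Qed.

End pairs.

(** * Growth of the sections and the center of mass of the polytope *)

Section growth.
Context {R : realType}.

(** The quadratic term of the binomial expansion already beats the polynomial factors to come. In
    the induction the surplus is the cubic term [m(m - 1)/2 * x^3]. *)
Lemma binomial_lower2 (x : R) m : 0 <= x ->
  m%:R * (m%:R - 1) / 2 * x ^+ 2 < (1 + x) ^+ m.
Proof.
move=> x0; suff H : 1 + m%:R * x + m%:R * (m%:R - 1) / 2 * x ^+ 2 <= (1 + x) ^+ m.
  apply: lt_le_trans H; by rewrite ltrDr ltr_pwDl// mulr_ge0.
elim: m => [|m IH]; first by rewrite expr0; lra.
rewrite [(1 + x) ^+ m.+1]exprS; have h := ler_wpM2l (addr_ge0 ler01 x0) IH.
apply: le_trans h; rewrite -(natr1 m).
have mm : 0 <= m%:R * (m%:R - 1) / 2 * x ^+ 3.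
  case: m {IH} => [|m]; first by rewrite !mul0r.
  by rewrite !mulr_ge0 ?exprn_ge0// -natr1 addrK.
rewrite -subr_ge0; apply: le_trans mm _; rewrite le_eqVlt; apply/orP; left;
  apply/eqP; by field.
Qed.

End growth.

Section pair_center.
Context {R : realType} (m : nat).
Hypothesis m_gt0 : (0 < m)%N.
Local Notation n := (m.+1%:R : R).
Local Notation hd x := (x ord0 ord0).
Local Notation tl x j := (x ord0 (lift ord0 j)).

(* If the two largest entries of [|y|] sum to at most [h], then all entries but
   one are at most [h / 2]. *)
Definition spike_box (h : R) (i : 'I_m) : set 'rV[R]_m :=
  [set y : 'rV[R]_m | forall j, `|y ord0 j| <= if j == i then h else h / 2].

(** Allowing one long coordinate only doubles the volume [h ^+ m] of the cube of side [h]. *)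
Lemma lebesgue_spike_box h i : 0 <= h ->
  lebesgue_rV R m (spike_box h i) = (2 * h ^+ m)%:E.
Proof.
move=> h0; rewrite lebesgue_rV_symmetric_box; last by move=> j; case: ifP => _; lra.
rewrite (bigD1 i)//= eqxx (eq_bigr (fun=> h)); last first.
  by move=> j /negPf ->; rewrite mulr2n; lra.
rewrite prodr_const cardC1 card_ord -[h in RHS]mulr1 -mulr_natr.
by rewrite -[in RHS](prednK m_gt0) exprMn expr1n mulr1 exprS; congr EFin; ring.
Qed.

(** The heights n/12, n/8, n/6 serve as [s], [s'], [t]. The sections below n/12 are covered by m
    spike boxes, and those between n/8 and n/6 contain a cube. *)
Lemma pair_polytope_center : 300 ^+ 2 <= n ->
  n / 12 < center_of_mass (@pair_polytope R m) ord0 ord0.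
Proof.
move=> n_large.
(* [h] is 3/2 + 1/12, the pair bound at height n/12. The 13/16 in [A'] is half of 3/2 + 1/8, the
   pair bound at n/8; as 13/16 + 1/6 < 1, the cone still contains this cube at height n/6. *)
pose h : R := 19 / 12.
pose A := \bigcup_(i in [set: 'I_m]) spike_box h i.
pose A' := [set y : 'rV[R]_m | forall j, `|y ord0 j| <= 13 / 16].
have n0 : 0 < n by [].
have mA : measurable A.
  by apply: fin_bigcup_measurable => [|i _];
    [exact: finite_finset|exact: measurable_symmetric_box].
have muA : (lebesgue_rV R m A <= (m%:R * (2 * h ^+ m))%:E)%E.
  rewrite -[X in X%:R](card_ord m);
    apply: (@measure_bigcup_finType_le _ _ _ (lebesgue_rV R m) _ (spike_box h)) => i.
    exact: measurable_symmetric_box.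
  by rewrite [leLHS]lebesgue_spike_box// /h; lra.
have Afin : lebesgue_rV R m A \is a fin_num.
  by rewrite ge0_fin_numE// (le_lt_trans muA)// ltry.
have muA' : lebesgue_rV R m A' =
  ((13 / 16 *+ 2) ^+ m)%:E by rewrite lebesgue_rV_cube//; lra.
have nn : n * n^-1 = 1 by rewrite divff// gt_eqF.
apply: (@center_of_mass_gt _ _ _ A A' (n / 12) (n / 8) (n / 6) n) => //.
- exact: measurable_halfspaces.
- apply: (@lebesgue_coord_bounded _ _ _ (n + 4)) => //; last exact: pair_polytope_coord.
  exact: measurable_halfspaces.
- move=> x /pair_polytope_cone Cx; have [x0 _] := cone_bounds m_gt0 Cx.
  by have [-> _] := Cx.
- by rewrite -ge0_fin_numE.
- exact: measurable_cube.
- by rewrite muA' ltry.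
- lra.
- lra.
- lra.
- move=> x /pair_polytopeP[_ H1 H2] xs.
  have xn : hd x / n <= 1 / 12 by rewrite ler_pdivrMr//; lra.
  have le_h (y : R) : y <= 3 / 2 + hd x / n -> y <= h.
    by rewrite /h; move: xn; set q := hd x / n; clearbody q; lra.
  have H1' i := le_h _ (H1 i); have H2' i j ij := le_h _ (H2 i j ij).
  (* A coordinate above [h / 2] pushes all others below it; if there is none, any index can play the
     spike. *)
  have [[i hi]|no] := pselect (exists i : 'I_m, h / 2 < `|tl x i|).
    exists i => // j; rewrite /rV_behead mxE; case: eqVneq => [_|ji]; first exact: H1'.
    by have := H2' _ _ ji; lra.
  exists (Ordinal m_gt0) => // j; rewrite /rV_behead mxE.
  case: eqVneq => _; first exact: H1'.
  by rewrite leNgt; apply/negP => hj; apply: no; exists j.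
- move=> x /andP[x1 x2] H.
  have {}H (j : 'I_m) : `|tl x j| <= 13 / 16 by have := H j; rewrite mxE.
  have q1 : 1 / 8 <= hd x / n by rewrite ler_pdivlMr//; lra.
  have q2 : hd x / n <= 1 / 6 by rewrite ler_pdivrMr//; lra.
  apply/pair_polytopeP; split.
  + split=> [|j]; first by lra.
    have : @cone_slope R m * `|tl x j| <= 1 * `|tl x j|.
      by rewrite ler_wpM2r// cone_slope_le1.
    move: (H j) q2; set q := hd x / n; set p := _ * `|_|; clearbody q p; lra.
  + move=> i; move: (H i) q1; set q := hd x / n; clearbody q; lra.
  + move=> i j _; move: (H i) (H j) q1; set q := hd x / n; clearbody q; lra.
rewrite muA' /=.
have {}muA : fine (lebesgue_rV R m A) <= m%:R * (2 * h ^+ m).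
  by rewrite -lee_fin fineK.
(* The cube in the slab is wider than [h] by the factor 39/38, independent of n; its m-th power
   provides the growth. *)
have -> : 13 / 16 *+ 2 = h * (1 + 1 / 38) by rewrite /h; field.
rewrite exprMn.
have hm : 0 < h ^+ m by rewrite exprn_gt0// /h; lra.
have := @binomial_lower2 R (1 / 38) m ltac:(lra).
have nE : m%:R = n - 1 :> R by rewrite -natr1 addrK.
set B := (1 + 1 / 38) ^+ m => HB.
(* 18m collects the union bound 2m and the ratio (1/8)^2 / (1/24)^2 = 9 of the height factors. The
   quadratic term wins once m - 1 >= 18 * 2888 = 51984, which n >= 300^2 ensures. *)
have Bm : 18 * m%:R < B.
  apply: le_lt_trans HB.
  rewrite (_ : _ / 2 * _ = (m%:R - 1) / 2888 * m%:R); last by field.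
  by rewrite ler_wpM2r// nE; move: n_large; rewrite expr2; lra.
have step1 : (n / 12 + 1) ^+ 2 <= (n / 8) ^+ 2.
  rewrite ler_sqr ?nnegrE; move: n_large; rewrite expr2; lra.
apply: (@le_lt_trans _ _ ((n / 8) ^+ 2 * (m%:R * (2 * h ^+ m)))).
  by apply: ler_pM; rewrite ?sqr_ge0 ?fine_ge0.
rewrite (_ : (n / 8) ^+ 2 * (m%:R * (2 * h ^+ m)) =
  (n ^+ 2 / 576 * h ^+ m) * (18 * m%:R)); last by field.
rewrite (_ : (n / 8 - n / 12) * (n / 6 - n / 8) * (h ^+ m * B) =
  (n ^+ 2 / 576 * h ^+ m) * B); last by field.
rewrite ltr_pM2l; first exact: Bm.
by apply: mulr_gt0; [apply: divr_gt0; rewrite ?exprn_gt0 ?ltr0n|exact: hm].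
Qed.

End pair_center.

(** * The round body *)

Section round.
Context {R : realType} (m : nat).
Hypothesis m_gt0 : (0 < m)%N.
Local Notation n := (m.+1%:R : R).
Local Notation hd x := (x ord0 ord0).
Local Notation tl x j := (x ord0 (lift ord0 j)).
Local Notation kappa := (lebesgue_rV R m euclidean_ball).

(* The second condition says that the Euclidean norm of [rV_behead x] is at
   most [2 + hd x / n], as a family of linear inequalities. *)
Definition round_body : set 'rV[R]_m.+1 :=
  @cone R m `&` [set x | forall v : {v : 'rV[R]_m | euclidean_ball v},
    dotv (rV_cons (- n^-1, sval v)) x <= 2].

Lemma dotv_rV_cons a (v : 'rV[R]_m) x :
  dotv (rV_cons (a, v)) x = a * hd x + dotv v (rV_behead x).
Proof.
rewrite /dotv big_ord_recl !mxE unlift_none; congr (_ + _).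
by apply: eq_bigr => i _; rewrite !mxE liftK.
Qed.

Lemma cone_hd x : @cone R m x -> 1 <= 2 + hd x / n.
Proof.
move=> [x0 _]; suff : -1 <= hd x / n by set q := _ / n; clearbody q; lra.
by rewrite ler_pdivlMr// mulN1r (le_trans _ x0)// lerN2 ler1n.
Qed.

(** The Euclidean norm is the supremum of [dotv v] over the unit ball, attained at the normalized
    vector. Squaring is harmless because the cone keeps [2 + x_0 / n] positive. The linear form
    serves convexity and closedness, the quadratic one volumes. *)
Lemma round_bodyP x : round_body x <->
  cone x /\ dotv (rV_behead x) (rV_behead x) <= (2 + hd x / n) ^+ 2.
Proof.
rewrite /round_body; split=> -[Cx H]; split=> //; have g1 := cone_hd Cx;
  set y := rV_behead x in H *.
- have [y0|y0] := eqVneq (dotv y y) 0; first by rewrite y0 sqr_ge0.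
  have yy : 0 < dotv y y by rewrite lt_def y0 dotv_ge0.
  set r := Num.sqrt (dotv y y).
  have r2 : r ^+ 2 = dotv y y by rewrite sqr_sqrtr// ltW.
  have r0 : 0 < r by rewrite sqrtr_gt0.
  have vB : euclidean_ball (r^-1 *: y).
    rewrite /euclidean_ball/= dotvZl dotvZr -r2 expr2 mulKf ?gt_eqF//.
    by rewrite mulVf ?gt_eqF.
  have := H (exist _ _ vB); rewrite dotv_rV_cons/= dotvZl -/y -r2 expr2 mulKf ?gt_eqF//.
  rewrite mulNr (mulrC n^-1) => h.
  have {}h : r <= 2 + hd x / n by move: h; set q := _ / n; clearbody q; lra.
  by rewrite -expr2 ler_sqr// nnegrE ltW// (lt_le_trans r0).
- move=> [v vB] /=; rewrite dotv_rV_cons -/y mulNr (mulrC n^-1).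
  move: g1 H; set q := hd x / n; clearbody q => g1 H.
  have g0 : 0 < 2 + q by lra.
  have : dotv v ((2 + q)^-1 *: y) <= 1.
    apply: dotv_le1 => //; rewrite dotvZl dotvZr mulrA -expr2 exprVn.
    by rewrite ler_pdivrMl ?exprn_gt0// mulr1.
  by rewrite dotvZr ler_pdivrMl// mulr1; lra.
Qed.

Lemma cone_halfspaces : @cone R m = [set x | forall i, dotv (cone_normal i) x <= 1].
Proof.
apply/seteqP; split=> x.
  by move=> /coneP H i; rewrite dotvC.
by move=> H; apply/coneP => i; rewrite dotvC; exact: H.
Qed.

Lemma ball_sub_round_body : euclidean_ball `<=` round_body.
Proof.
move=> x xB; have Cx := ball_sub_cone xB; apply/round_bodyP; split => //.
apply: (@le_trans _ _ 1); last by rewrite exprn_ege1// cone_hd.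
apply: le_trans xB; rewrite /dotv big_ord_recl -[leLHS]add0r lerD//.
  by rewrite -expr2 sqr_ge0.
by apply: ler_sum => i _; rewrite !mxE.
Qed.

Lemma round_body_cone : round_body `<=` @cone R m.
Proof. by move=> x []. Qed.

Lemma round_body_coord x : round_body x -> forall i, `|x ord0 i| <= n + 4.
Proof. move=> /round_body_cone; exact: cone_coord. Qed.

Lemma round_body_convex_body : convex_body round_body.
Proof.
apply: (@convex_body_ball _ _ _ (n + 4)) => //.
- exact: round_body_coord.
- by apply: closedI; rewrite ?cone_halfspaces; exact: closed_halfspaces.
- move=> x y t t01 [Cx Hx] [Cy Hy]; split; last exact: convex_halfspaces.
  by move: Cx Cy; rewrite cone_halfspaces => Cx Cy; exact: convex_halfspaces.
- exact: ball_sub_round_body.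
Qed.

Lemma measurable_round_body : measurable round_body.
Proof.
have -> : round_body = @cone R m `&` [set x |
    dotv (rV_behead x) (rV_behead x) <= (2 + hd x / n) ^+ 2].
  by apply/seteqP; split=> x /round_bodyP.
apply: measurableI; first by rewrite cone_halfspaces; exact: measurable_halfspaces.
apply: measurable_le_set.
  by apply: measurable_dotv; exact: measurable_rV_behead.
apply: measurable_funX; apply: measurable_funD => //; apply: measurable_funM => //.
exact: (measurable_rV_coord (T:=R)).
Qed.

(* Most of the ball of radius [rho] lies in the cube of side [2 eps]: the part
   with [+-y_j > eps] is contained in the ball of radius
   [sqrt (rho^2 - eps^2)] around [+-eps e_j]. *)
Lemma ball_cap_cube_ge (rho eps : R) : 0 < eps -> eps < rho ->
  (2 * m)%:R * Num.sqrt (rho ^+ 2 - eps ^+ 2) ^+ m <= rho ^+ m / 2 ->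
  ((rho ^+ m / 2)%:E * kappa <=
   lebesgue_rV R m ([set y | (dotv y y <= rho ^+ 2)%R] `&`
     [set y | forall j, (`|y ord0 j| <= eps)%R]))%E.
Proof.
move=> e0 er; set r := Num.sqrt _ => hr.
have r2 : r ^+ 2 = rho ^+ 2 - eps ^+ 2.
  by rewrite sqr_sqrtr// subr_ge0 ler_sqr ?nnegrE//; lra.
have r0 : 0 < r.
  by rewrite sqrtr_gt0 subr_gt0 ltr_sqr ?nnegrE//; lra.
set A' := _ `&` _.
pose z (p : 'I_m * bool) : 'rV[R]_m := ((-1) ^+ p.2 * eps) *: delta_mx 0 p.1.
pose U := \bigcup_(p in [set: 'I_m * bool]) [set y | dotv (y - z p) (y - z p)
  <= r ^+ 2].
have kfin : kappa \is a fin_num by rewrite ge0_fin_numE// lebesgue_ball_lty.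
set k := fine kappa.
have kE : kappa = k%:E by rewrite fineK.
have muU : (lebesgue_rV R m U <= ((2 * m)%:R * (r ^+ m * k))%:E)%E.
  rewrite mulnC -[X in (X * 2)%N](card_ord m) -[X in (_ * X)%N]card_bool -card_prod.
  apply: (@measure_bigcup_finType_le _ _ _ (lebesgue_rV R m) _
    (fun p => [set y | dotv (y - z p) (y - z p) <= r ^+ 2])) => p.
    exact: measurable_dotv_ball.
  by rewrite [leLHS]lebesgue_rV_ball// kE.
have mU : measurable U.
  apply: fin_bigcup_measurable => [|p _]; first exact: finite_finset.
  exact: measurable_dotv_ball.
have mA' : measurable A'.
  apply: measurableI; last exact: measurable_cube.
  have := measurable_dotv_ball (0 : 'rV[R]_m) (rho ^+ 2).
  by under eq_set do rewrite subr0.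
pose D := [set y : 'rV[R]_m | dotv (y - 0) (y - 0) <= rho ^+ 2].
have mD : measurable D by exact: measurable_dotv_ball.
have DA : D `<=` A' `|` U.
  move=> y; rewrite /D/= subr0 => yD.
  have [H|no] := pselect (forall j, `|y ord0 j| <= eps); first by left; split.
  right; have [j hj] : exists j, eps < `|y ord0 j|.
    apply: contrapT => /forallNP H; apply: no => j.
    by rewrite leNgt; apply/negP; exact: H.
  exists (j, y ord0 j < 0) => //=.
  rewrite !(dotvDl, dotvDr, dotvNl, dotvNr, dotvZl, dotvZr) !dotv_delta.
  rewrite (dotvC (delta_mx _ _) y) dotv_delta mxE !eqxx /= mulr1.
  rewrite mulrACA -expr2 sqrr_sign mul1r (mulrAC _ eps) -normrEsign r2.
  (* |y - z|^2 = |y|^2 - 2 eps |y_j| + eps^2, which is at most rho^2 - eps^2 as |y_j| > eps. *)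
  have : eps * eps <= eps * `|y ord0 j| by rewrite ler_wpM2l// ltW.
  by rewrite !expr2; move: yD; rewrite expr2; lra.
have : (lebesgue_rV R m D <= lebesgue_rV R m A' + lebesgue_rV R m U)%E.
  apply: (@le_trans _ _ (lebesgue_rV R m (A' `|` U))).
    by apply: le_measure; rewrite ?inE//; exact: measurableU.
  exact: measureU2.
rewrite lebesgue_rV_ball; last by lra.
rewrite kE -!EFinM => h.
have {h} : ((rho ^+ m * k)%:E <= lebesgue_rV R m A' + ((2 * m)%:R * (r ^+ m * k))%:E)%E.
  by apply: (le_trans h); rewrite leeD2l.
rewrite -leeBlDr// -EFinB; apply: le_trans; rewrite lee_fin.
have k0 : 0 <= k by exact: fine_ge0.
have := ler_wpM2r k0 hr; rewrite mulrA; lra.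
Qed.

End round.

(** * The center of mass of the round body *)

Section round_center.
Context {R : realType} (m : nat).
Hypothesis m_gt3 : (3 < m)%N.
Local Notation n := (m.+1%:R : R).
Local Notation hd x := (x ord0 ord0).
Local Notation tl x j := (x ord0 (lift ord0 j)).
Local Notation kappa := (lebesgue_rV R m euclidean_ball).

Let m_gt0 : (0 < m)%N. Proof. exact: leq_trans m_gt3. Qed.

(** As rho <= 3, the radicand is at most rho^2 (1 - eps^2 / 9) <= rho^2 exp(- eps^2 / 9); the square
    root halves the exponent, hence the 18. *)
Lemma sqrt_pow_le_expR (rho eps : R) : 0 < eps -> eps < rho -> rho <= 3 ->
  Num.sqrt (rho ^+ 2 - eps ^+ 2) ^+ m <= rho ^+ m * expR (- (m%:R * eps ^+ 2 / 18)).
Proof.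
move=> e0 er r3; have rho0 : 0 < rho by lra.
have -> : expR (- (m%:R * eps ^+ 2 / 18)) = expR (- (eps ^+ 2 / 18)) ^+ m.
  by rewrite -expRM_natl; congr expR; field.
rewrite -exprMn; apply: lerXn2r;
  rewrite ?nnegrE ?sqrtr_ge0 ?mulr_ge0 ?expR_ge0 ?(ltW rho0)//.
rewrite -(@ler_sqr _ (Num.sqrt _)) ?nnegrE ?sqrtr_ge0 ?mulr_ge0 ?expR_ge0 ?(ltW rho0)//.
rewrite sqr_sqrtr; last by rewrite subr_ge0 ler_sqr ?nnegrE//; lra.
rewrite exprMn -expRM_natl.
have -> : 2%:R * - (eps ^+ 2 / 18) = - (eps ^+ 2 / 9) :> R by field.
have h := expR_ge1Dx (- (eps ^+ 2 / 9)).
have h2 := ler_wpM2l (sqr_ge0 rho) h.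
apply: le_trans h2.
have : rho ^+ 2 * (eps ^+ 2 / 9) <= 9 * (eps ^+ 2 / 9).
  rewrite ler_wpM2r ?divr_ge0 ?sqr_ge0//.
  have -> : 9 = 3 ^+ 2 :> R by ring.
  by rewrite ler_sqr ?nnegrE//; lra.
lra.
Qed.

(** The heights (1 - 3 eps) n, (1 - 2 eps) n and (1 - eps) n serve as [s], [s'], [t]. The radii
    [rho] and [rho'] are the values of 2 + x_0 / n at the first two; the third is where the cone's
    section still contains the cube of half side eps. *)
Lemma round_body_center (eps : R) : 0 < eps -> 3 * eps <= 1 ->
  81 * ln n <= n * eps ^+ 2 -> 1 <= ln n ->
  (1 - 3 * eps) * n < center_of_mass (@round_body R m) ord0 ord0.
Proof.
move=> e0 e3 en ln1.
have n0 : 0 < n by [].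
have mE : m%:R = n - 1 :> R by rewrite -natr1 addrK.
have n5 : 5 <= n by rewrite ler_nat.
pose rho := 3 - 3 * eps; pose rho' := 3 - 2 * eps.
pose A := [set y : 'rV[R]_m | dotv (y - 0) (y - 0) <= rho ^+ 2].
pose A' := [set y : 'rV[R]_m | dotv y y <= rho' ^+ 2] `&` [set y |
  forall j, `|y ord0 j| <= eps].
have mA : measurable A by exact: measurable_dotv_ball.
have mA' : measurable A'.
  apply: measurableI; last exact: measurable_cube.
  have := measurable_dotv_ball (0 : 'rV[R]_m) (rho' ^+ 2).
  by under eq_set do rewrite subr0.
have kfin : kappa \is a fin_num by rewrite ge0_fin_numE// lebesgue_ball_lty.
set k := fine kappa.
have kE : kappa = k%:E by rewrite fineK.
have k0 : 0 < k by rewrite fine_gt0// lebesgue_ball_gt0 lebesgue_ball_lty.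
have muA : lebesgue_rV R m A = (rho ^+ m * k)%:E.
  by rewrite lebesgue_rV_ball ?kE// /rho; lra.
have A'oo : (lebesgue_rV R m A' < +oo)%E.
  apply: (@lebesgue_coord_bounded _ _ _ eps) => //; first exact: ltW.
  by move=> y [].
have half : (rho' ^+ m / 2) * k <= fine (lebesgue_rV R m A').
  rewrite -lee_fin fineK ?ge0_fin_numE// EFinM -kE.
  apply: ball_cap_cube_ge => //; first by rewrite /rho'; lra.
  have r0 : 0 < rho' ^+ m by rewrite exprn_gt0// /rho'; lra.
  have := @sqrt_pow_le_expR rho' eps e0
    ltac:(rewrite /rho'; lra) ltac:(rewrite /rho'; lra).
  move=> /(ler_wpM2l (ler0n R (2 * m))) h; apply: le_trans h _.
  rewrite mulrCA ler_wpM2l ?(ltW r0)//.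
  (* Each cap must be small against 1/m. With m >= 4n/5, the bound 81 ln n yields an exponent of at
     least 3.6 ln n, more than the 2 ln n needed here. *)
  have : expR (- (m%:R * eps ^+ 2 / 18)) <= n ^- 2.
    have -> : n ^- 2 = expR (- (2 * ln n)).
      by rewrite expRN mulrC expRM_natr lnK// posrE.
    rewrite ler_expR lerN2.
    have : 4 / 5 * n * eps ^+ 2 <= m%:R * eps ^+ 2.
      by rewrite ler_wpM2r ?sqr_ge0// mE; lra.
    by move: en; rewrite -mulrA; set q := n * _; set p := m%:R * _; lra.
  move=> hE; apply: (@le_trans _ _ ((2 * n) * n ^- 2)).
    apply: ler_pM; [exact: ler0n|exact: expR_ge0| |exact: hE].
    by rewrite natrM mE; lra.
  rewrite (_ : 2 * n * n ^- 2 = 2 / n); last by field; rewrite gt_eqF.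
  by rewrite ler_pdivrMr//; lra.
have nn : n * n^-1 = 1 by rewrite divff// gt_eqF.
apply: (@center_of_mass_gt _ _ _ A A' _ ((1 - 2 * eps) * n) ((1 - eps) * n) n) => //.
- exact: measurable_round_body.
- apply: (@lebesgue_coord_bounded _ _ _ (n + 4)) => //; last exact: round_body_coord.
  exact: measurable_round_body.
- move=> x /round_body_cone Cx; have [x0 _] := cone_bounds m_gt0 Cx.
  by have [-> _] := Cx.
- by rewrite muA ltry.
- by apply: (@le_trans _ _ 0); [lra|rewrite mulr_ge0//; lra].
- by rewrite ler_wpM2r//; lra.
- by rewrite ler_wpM2r//; lra.
- move=> x /round_bodyP[Cx H] xs; rewrite /A/= subr0; apply: le_trans H _.
  have := cone_hd Cx.
  have : hd x / n <= 1 - 3 * eps by rewrite ler_pdivrMr// ltW.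
  set q := hd x / n; clearbody q => q1 q2.
  by rewrite ler_sqr ?nnegrE /rho; lra.
- move=> x /andP[x1 x2] [H1 H2].
  have q1 : 1 - 2 * eps <= hd x / n by rewrite ler_pdivlMr.
  have q2 : hd x / n <= 1 - eps by rewrite ler_pdivrMr.
  apply/round_bodyP; split; [split=> [|j]|].
  + by apply: le_trans x1; apply: (@le_trans _ _ 0); [lra|rewrite mulr_ge0//; lra].
  + have : @cone_slope R m * `|tl x j| <= 1 * `|tl x j|.
      by rewrite ler_wpM2r// cone_slope_le1.
    have := H2 j; rewrite mxE.
    move: q2; set q := hd x / n; set p := _ * `|_|; clearbody q p; lra.
  + apply: le_trans H1 _; move: q1; set q := hd x / n; clearbody q => q1.
    by rewrite ler_sqr ?nnegrE /rho'; lra.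
rewrite muA /=.
set N2 := n ^+ 2; have N20 : 0 < N2 by rewrite exprn_gt0.
apply: (@lt_le_trans _ _ ((N2 * eps ^+ 2) * (rho' ^+ m / 2 * k))); last first.
  rewrite (_ : _ * ((1 - eps) * n - _) = N2 * eps ^+ 2); last by rewrite /N2; ring.
  by rewrite ler_wpM2l// mulr_ge0// ?sqr_ge0// ltW.
apply: (@le_lt_trans _ _ ((4 * N2) * (rho ^+ m * k))).
  rewrite ler_wpM2r//; first by rewrite mulr_ge0 ?exprn_ge0 ?(ltW k0)// /rho; lra.
  rewrite /N2 (_ : 4 * n ^+ 2 = (2 * n) ^+ 2); last by ring.
  have h1 : 0 <= (1 - 3 * eps) * n by rewrite mulr_ge0//; lra.
  have h2 : (1 - 3 * eps) * n <= 1 * n by rewrite ler_wpM2r//; lra.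
  by rewrite ler_sqr ?nnegrE//; lra.
(* The product is 3 - 2 eps - eps^2. *)
have rr : rho * (1 + eps / 3) <= rho' by rewrite /rho /rho'; have := sqr_ge0 eps;
  rewrite expr2; lra.
have rho0 : 0 < rho by rewrite /rho; lra.
have growth : rho ^+ m * (1 + eps / 3) ^+ m <= rho' ^+ m.
  rewrite -exprMn lerXn2r ?nnegrE//; first by rewrite mulr_ge0 ?(ltW rho0)//; lra.
  by rewrite /rho'; lra.
have B := @binomial_lower2 R (eps / 3) m ltac:(lra).
(* The 8 collects the 4 from [(s + 1)^2 <= (2n)^2] and the 2 from keeping half of the ball. The
   quadratic term gives about (n eps^2)^2 / 18, which is large since n eps^2 >= 81. *)
have key : 8 < eps ^+ 2 * (1 + eps / 3) ^+ m.
  have q0 := sqr_ge0 eps; have nq : 81 <= n * eps ^+ 2 by lra.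
  have nq2 : 81 ^+ 2 <= (n * eps ^+ 2) ^+ 2 by rewrite ler_sqr ?nnegrE//; lra.
  have mm : 12 / 25 * n ^+ 2 <= m%:R * (m%:R - 1).
    have := ler_pM (_ : 0 <= 4 / 5 * n) (_ : 0 <= 3 / 5 * n)
      (_ : 4 / 5 * n <= m%:R) (_ : 3 / 5 * n <= m%:R - 1).
    rewrite mE (_ : 4 / 5 * n * (3 / 5 * n) = 12 / 25 * n ^+ 2); last by field.
    by apply; lra.
  have := ler_wpM2l q0 (ltW B); apply: lt_le_trans.
  rewrite (_ : _ * (_ * _) = m%:R * (m%:R - 1) * (eps ^+ 2) ^+ 2 / 18); last by field.
  have := ler_wpM2r (sqr_ge0 (eps ^+ 2)) mm.
  rewrite (_ : 12 / 25 * n ^+ 2 * (eps ^+ 2) ^+ 2 = 12 / 25 * (n * eps ^+ 2) ^+ 2);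
    last by ring.
  move: nq2; set u := (n * _) ^+ 2; set v := _ * (eps ^+ 2) ^+ 2; rewrite expr2; lra.
have rm0 : 0 < rho ^+ m by rewrite exprn_gt0.
have : 8 * rho ^+ m < eps ^+ 2 * rho' ^+ m.
  apply: (@lt_le_trans _ _ (eps ^+ 2 * (rho ^+ m * (1 + eps / 3) ^+ m))); last first.
    by rewrite ler_wpM2l// sqr_ge0.
  by rewrite mulrCA mulrC ltr_pM2l.
move=> h; have := mulr_gt0 N20 k0; set c := N2 * k => c0.
have := h; rewrite -(ltr_pM2r c0) /c => {}h.
rewrite (_ : 4 * N2 * (rho ^+ m * k) = (8 * rho ^+ m * (N2 * k)) / 2); last by field.
rewrite (_ : N2 * eps ^+ 2 * (rho' ^+ m / 2 * k) =
  (eps ^+ 2 * rho' ^+ m * (N2 * k)) / 2); last by field.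
by rewrite ltr_pM2r// invr_gt0.
Qed.

End round_center.

(** * Choice of the constants and conclusion *)

Lemma log_large (R : realType) (x : R) : 40 ^+ 4 <= x ->
  1 <= ln x /\ 27 * Num.sqrt (ln x / x) <= 1.
Proof.
move=> x_large; set r := Num.sqrt x.
have c0 : 0 < 40 :> R by rewrite ltr0n.
have x0 : 0 < x := lt_le_trans (exprn_gt0 4 c0) x_large.
have r0 : 0 < r by rewrite sqrtr_gt0.
have r2 : r ^+ 2 = x by rewrite sqr_sqrtr// ltW.
have r_large : 1600 <= r.
  have <- : 40 ^+ 2 = 1600 :> R by ring.
  by rewrite -ler_sqr ?nnegrE ?(ltW r0) ?exprn_ge0 ?(ltW c0)// r2 -exprM.
have lnE : ln x = 2 * ln r by rewrite -r2 lnXn// mulr_natl.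
split.
  have := @le_ln1Dx R (r^-1 - 1).
  rewrite (addrC 1) subrK lnV ?posrE// => /(_ _) H.
  have ri : 0 < r^-1 by rewrite invr_gt0.
  have ri2 : r^-1 * 1600 <= 1 by rewrite mulrC ler_pdivrMr// mul1r.
  have : - ln r <= r^-1 - 1 by apply: H; lra.
  lra.
have lt_ln := ln_sublinear r0.
(* With [r] the square root of [x], ln x = 2 ln r < 2r, so ln x / x < 2/r; and 1600 exceeds 2 *
   27^2. *)
have le27 : ln x / x <= (1 / 27) ^+ 2.
  rewrite ler_pdivrMr// lnE -r2.
  have : 1600 * r <= r ^+ 2 by rewrite expr2 ler_wpM2r// ltW.
  rewrite [(1 / 27) ^+ 2]expr2; set r' := r ^+ 2; lra.
have : Num.sqrt (ln x / x) <= 1 / 27.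
  have -> : 1 / 27 = Num.sqrt ((1 / 27) ^+ 2) :> R by rewrite sqrtr_sqr ger0_norm//;
    lra.
  by rewrite ler_sqrt// exprn_gt0//; lra.
lra.
Qed.

Theorem theorem1p3 (R : realType) :
  exists (C0 C1 C : R) (n0 : nat),
    [/\ 0 < C0, 0 < C1, 0 < C &
      forall n : nat, (n0 <= n)%N ->
        (exists K : set 'rV[R]_n,
          convex_body K /\
          exists (B : set 'rV[R]_n) (c : 'rV[R]_n),
            [/\ john_ellipsoid K B, ellipsoid_centered c B &
                ~ dilate c ((1 - C0 * Num.sqrt (ln n%:R / n%:R)) * n%:R) B
                    (center_of_mass K)])
        /\
        (exists P : set 'rV[R]_n,
          [/\ polytope P, convex_body P,
              exists2 m : nat, m%:R <= C * n%:R ^+ 2 & facets P #<= `I_m &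
              exists (B : set 'rV[R]_n) (c : 'rV[R]_n),
                [/\ john_ellipsoid P B, ellipsoid_centered c B &
                    ~ dilate c (C1 * (n%:R / ln n%:R)) B (center_of_mass P)]])].
Proof.
(* 27 = 3 * 9, from the height (1 - 3 eps) n with eps = 9 sqrt (log n / n); 1/12 is the relative
   height reached by the polytope; 4 suffices since 1 + 2m + 4m^2 <= 4 (m+1)^2. The threshold 40^4
   makes 3 eps <= 1 and exceeds 300^2. *)
exists 27, (1 / 12), 4, (maxn 5 (Num.bound (40 ^+ 4 : R))).
split; [lra|lra|lra|move=> n].
rewrite geq_max => /andP[n5 nb].
have n_large : 40 ^+ 4 <= n%:R :> R.
  apply: ltW; apply: (@lt_le_trans _ _ (Num.bound (40 ^+ 4 : R))%:R).
    by apply: archi_boundP; rewrite exprn_ge0 ?ler0n.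
  by rewrite ler_nat.
have [ln1 sqrt1] := log_large n_large.
case: n n5 nb n_large ln1 sqrt1 => [//|m] n5 _ n_large ln1 sqrt1.
have m_gt3 : (3 < m)%N by [].
have m_gt0 : (0 < m)%N by exact: leq_trans m_gt3.
have n0 : 0 < m.+1%:R :> R by [].
set L := ln m.+1%:R in ln1 sqrt1 *.
have L0 : 0 < L by lra.
split.
  exists (@round_body R m); split; first exact: round_body_convex_body.
  exists euclidean_ball, 0; split.
  - by apply: john_ellipsoid_in_cone => //;
    [exact: ball_sub_round_body|exact: round_body_cone].
  - exact: ellipsoid_centered_ball.
  pose eps := 9 * Num.sqrt (L / m.+1%:R).
  have eps3 : 27 * Num.sqrt (L / m.+1%:R) = 3 * eps by rewrite /eps; ring.
  rewrite eps3; rewrite eps3 in sqrt1; apply: not_dilate_ball.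
    by rewrite mulr_ge0//; lra.
  apply: round_body_center => //.
  - by rewrite /eps mulr_gt0// sqrtr_gt0 divr_gt0.
  - rewrite /eps exprMn sqr_sqrtr; last by rewrite divr_ge0// ltW.
    by rewrite (_ : m.+1%:R * _ = 81 * L)//; field; rewrite gt_eqF.
exists (@pair_polytope R m); split.
- exact: pair_polytope_polytope.
- exact: pair_polytope_body.
- exists (1 + m * 2 + m * m * 4)%N; last exact: card_pair_polytope_facets.
  rewrite !natrD !natrM -natr1 -subr_ge0.
  rewrite [X in 0 <= X](_ : _ = 6 * m%:R + 3); last by ring.
  by rewrite addr_ge0// mulr_ge0.
exists euclidean_ball, 0; split.
- by apply: john_ellipsoid_in_cone => //;
    [exact: ball_sub_pair_polytope|exact: pair_polytope_cone].
- exact: ellipsoid_centered_ball.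
apply: not_dilate_ball; first by rewrite mulr_ge0 ?divr_ge0//; lra.
(* The polytope's center of mass lies above the linear height n/12; since ln n >= 1, this dominates
   the required n / (12 ln n). *)
apply: le_lt_trans (pair_polytope_center m_gt0 _); last first.
  apply: le_trans n_large; rewrite (exprM _ 2 2) ler_sqr ?nnegrE ?exprn_ge0 ?ler0n//.
  by rewrite expr2 -natrM ler_nat.
rewrite mulrC mulrA mulr1 ler_pM2r ?invr_gt0//.
by rewrite ler_pdivrMr// ler_peMr// ltW.
Qed.
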